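(* There are absolute constants $c_1,c_2,c_3>0$ such that the following holds. Let $\mathscr{F}=(F_1,\dots,F_M)$ be an ordered list of $Q$-clause $k$-CNFs over $x_1,\dots,x_n$. Let $\delta,p\in(0,1)$ and define $q=\log_2(1/p)$. Let $\mathcal{D}$ be any distribution over $\{0,1\}^{Y_q}$ that $\big(\delta/(M^{\lceil t/\ell\rceil}n^{c_1t})\big)$-fools the class of depth-3 circuits of size $M(n^{c_2\ell}+Q2^{c_3kq})$. Then for all $\ell\ge k$ and all $t\in\mathbb{N}$, \[\Pr_{(\boldsymbol\eta,\mathbf{z})\leftarrow\mathcal{D}}\big[\operatorname{depth}(\mathrm{CCDT}_\ell(\mathscr{F}\upharpoonright\rho(\boldsymbol\eta,\mathbf{z})))\ge t\big]\le16^{t+\ell}M^{\lceil t/\ell\rceil}(32pk)^t+\delta.\]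
   Context: $\{0,1\}^{Y_q}=\{0,1\}^{n\times q}\times\{0,1\}^n$ (with $q$ a positive integer). For $(\varrho,y)\in\{0,1\}^{Y_q}$, the restriction $\rho(\varrho,y)\in\{0,1,*\}^n$ has $\rho(\varrho,y)_i=*$ if $\varrho_{i,1}=\cdots=\varrho_{i,q}=1$ and $\rho(\varrho,y)_i=y_i$ otherwise. A distribution $\mathcal{D}$ $\gamma$-fools a class $\mathscr{C}$ if $|\mathbf{E}_{\mathcal{D}}[f]-\mathbf{E}_{\mathrm{uniform}}[f]|\le\gamma$ for all $f\in\mathscr{C}$; circuits have unbounded fan-in AND/OR gates over literals. Restrictions: $f\upharpoonright\rho$ fixes $x_i$ to $\rho_i$ when $\rho_i\in\{0,1\}$; $\mathscr{F}\upharpoonright\rho$ is applied componentwise. A $k$-CNF is an ordered sequence of clauses each an OR of at most $k$ literals ($Q$-clause: $Q$ clauses); under a restriction a clause is identically 1 if a literal is set true, identically 0 if all literals set false. $\mathrm{CDT}(F)$: constant 0 if some clause is identically 0; constant 1 if all are identically 1; otherwise query exhaustively the surviving variables of the first clause not identically 1 and recurse on $F\upharpoonright\eta$ at each leaf $\eta$. A root path $\eta=\eta^{(1)}\circ\cdots\circ\eta^{(u)}$ in $\mathrm{CDT}(F)$ splits into segments assigning variables of successively queried clauses; it is full if its last segment assigns all surviving variables of its clause. $\mathrm{CCDT}_\ell(\mathscr{F})$: (0) if $M=0$, only the empty tree; (1) if $\operatorname{depth}(\mathrm{CDT}(F_1))\le\ell$, equals $\mathrm{CCDT}_\ell((F_2,\dots,F_M))$;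 (2) otherwise, for any full path $\eta$ in $\mathrm{CDT}(F_1)$ of length between $\ell+1$ and $\ell+k$, take the tree querying all variables of $\eta$ exhaustively and at the end of each of its paths $\pi$ attach any tree of $\mathrm{CCDT}_\ell(\mathscr{F}\upharpoonright\pi)$; the set of all trees so obtained. $\operatorname{depth}(\mathrm{CCDT}_\ell(\mathscr{F}))$ is the maximum depth of a tree in the set. *)

(* Defs.v *)
From HB Require Import structures.
From mathcomp Require Import all_boot all_order all_algebra.
From mathcomp Require Import boolp reals exp.

Set Implicit Arguments.
Unset Strict Implicit.
Unset Printing Implicit Defensive.

Import Order.TTheory GRing.Theory Num.Theory.

Section Probability.
Local Open Scope ring_scope.
Variables (R : realType) (T : finType).

Definition is_distribution (D : {ffun T -> R}) : Prop :=
  (forall x, 0 <= D x) /\ \sum_x D x = 1.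

Definition expectation (D : {ffun T -> R}) (f : T -> bool) : R :=
  \sum_x D x * (f x)%:R.

Definition uniform : {ffun T -> R} := [ffun=> #|T|%:R^-1].

Definition Pr (D : {ffun T -> R}) (E : pred T) : R := \sum_(x | E x) D x.

Definition fools (D : {ffun T -> R}) (gamma : R) (K : (T -> bool) -> Prop) :
  Prop :=
  forall f, K f -> `|expectation D f - expectation uniform f| <= gamma.

End Probability.

Section Circuits.
Variable V : finType.

(* [inl (v, b)] is the literal satisfied by [x] iff [x v = b];
   [inr j] is the output of the j-th gate. *)
Definition wire : Type := (V * bool + nat)%type.

Record gate := Gate { is_and : bool; inputs : seq wire }.

(* Gates are listed in topological order, a gate may be read by any number of
   later gates, and the last gate is the output. *)
Definition circuit := seq gate.

Definition wire_ok (j : nat) (w : wire) : bool :=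
  if w is inr i then i < j else true.

Fixpoint gates_ok (j : nat) (c : circuit) : bool :=
  if c is g :: c' then all (wire_ok j) (inputs g) && gates_ok j.+1 c' else true.

Definition well_formed (c : circuit) : bool := (0 < size c) && gates_ok 0 c.

Definition wire_value (x : {ffun V -> bool}) (vs : seq bool) (w : wire) : bool :=
  match w with inl l => x l.1 == l.2 | inr i => nth false vs i end.

Definition gate_value x vs (g : gate) : bool :=
  if is_and g then all (wire_value x vs) (inputs g)
  else has (wire_value x vs) (inputs g).

Definition gate_values x (c : circuit) : seq bool :=
  foldl (fun vs g => rcons vs (gate_value x vs g)) [::] c.

Definition circuit_value (c : circuit) (x : {ffun V -> bool}) : bool :=
  last false (gate_values x c).

Definition wire_depth (ds : seq nat) (w : wire) : nat :=
  if w is inr i then nth 0 ds i else 0.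

Definition gate_depths (c : circuit) : seq nat :=
  foldl (fun ds g =>
    rcons ds (\max_(w <- inputs g) wire_depth ds w).+1) [::] c.

Definition circuit_depth (c : circuit) : nat := \max_(d <- gate_depths c) d.

(* The size of a circuit is its number of gates. *)
Definition circuit_class (R : realType) (d : nat) (S : R)
    (f : {ffun V -> bool} -> bool) : Prop :=
  exists c : circuit,
    [/\ well_formed c, circuit_depth c <= d, ((size c)%:R <= S)%R
      & f =1 circuit_value c].

End Circuits.

Section CNF.
Variable n : nat.

(* [None] is the star. *)
Definition restriction : predArgType := {ffun 'I_n -> option bool}.

(* The literal [(i, b)] is satisfied by [x] iff [x i = b]. *)
Definition clause : predArgType := {set 'I_n * bool}.

Definition cnf : predArgType := seq clause.

Definition is_kCNF (Q k : nat) (F : cnf) : bool :=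
  (size F == Q) && all (fun C : clause => #|C| <= k) F.

Definition clause_value (C : clause) (x : {ffun 'I_n -> bool}) : bool :=
  [exists l in C, x l.1 == l.2].

Definition cnf_value (F : cnf) x : bool := all (fun C => clause_value C x) F.

Definition clause_vars (C : clause) : {set 'I_n} := [set l.1 | l in C].

(* A clause containing a literal and its negation is identically 1. *)
Definition identically0 (C : clause) : bool := [forall x, ~~ clause_value C x].
Definition identically1 (C : clause) : bool := [forall x, clause_value C x].

Definition satisfied_by (rho : restriction) (C : clause) : bool :=
  [exists l in C, rho l.1 == Some l.2].

(* A clause with a literal set true is dropped from the sequence; otherwise its
   literals set false are erased (see [cnf_value_restrict] below). *)
Definition restrict_clause (rho : restriction) (C : clause) : clause :=
  [set l in C | rho l.1 == None].

Definition restrict_cnf (rho : restriction) (F : cnf) : cnf :=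
  [seq restrict_clause rho C | C <- F & ~~ satisfied_by rho C].

Definition restrict_list (rho : restriction) (FF : seq cnf) : seq cnf :=
  [seq restrict_cnf rho F | F <- FF].

Definition overwrite (rho : restriction) (x : {ffun 'I_n -> bool}) :
  {ffun 'I_n -> bool} := [ffun i => odflt (x i) (rho i)].

Definition dpath : predArgType := seq ('I_n * bool).

Definition restr_of (s : dpath) : restriction :=
  [ffun i => ohead [seq a.2 | a <- s & a.1 == i]].

Inductive dtree (A : Type) : Type :=
| Leaf of A
| Query of 'I_n & dtree A & dtree A.

Fixpoint dt_depth A (T : dtree A) : nat :=
  if T is Query _ T0 T1 then (maxn (dt_depth T0) (dt_depth T1)).+1 else 0.

Fixpoint root_path A (T : dtree A) (s : dpath) : bool :=
  match s, T with
  | [::], _ => true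
  | a :: s', Query i T0 T1 => (a.1 == i) && root_path (if a.2 then T1 else T0) s'
  | _ :: _, Leaf _ => false
  end.

(* The complete tree on [vs], with [sub pi] attached at the end of each of its
   paths [pi]. *)
Fixpoint query_all A (vs : seq 'I_n) (sub : dpath -> dtree A) : dtree A :=
  if vs is i :: vs' then
    Query i (query_all vs' (fun pi => sub ((i, false) :: pi)))
            (query_all vs' (fun pi => sub ((i, true) :: pi)))
  else sub [::].

Definition first_live (F : cnf) : option clause :=
  ohead [seq C <- F | ~~ identically1 C].

(* Each round queries a new variable, so n rounds suffice: see [cdtE]. *)
Fixpoint cdt_rec (m : nat) (F : cnf) : dtree bool :=
  if has identically0 F then Leaf false
  else if first_live F is Some C then
    if m is m'.+1 then
      query_all (enum (clause_vars C))
        (fun pi => cdt_rec m' (restrict_cnf (restr_of pi) F))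
    else Leaf false
  else Leaf true.

Definition cdt (F : cnf) : dtree bool := cdt_rec n F.

(* The root paths of CDT(F) whose last segment is complete: [s] is a segment
   assigning all the surviving variables of the clause queried by CDT(F). *)
Inductive full_path : cnf -> dpath -> Prop :=
| FullLast F C s :
    ~~ has identically0 F -> first_live F = Some C ->
    unzip1 s = enum (clause_vars C) -> full_path F s
| FullCons F C s s' :
    ~~ has identically0 F -> first_live F = Some C ->
    unzip1 s = enum (clause_vars C) ->
    full_path (restrict_cnf (restr_of s) F) s' -> full_path F (s ++ s').

Inductive ccdt (l k : nat) : seq cnf -> dtree unit -> Prop :=
| CCDT_nil : ccdt l k [::] (Leaf tt)
| CCDT_skip F FF T :
    dt_depth (cdt F) <= l -> ccdt l k FF T -> ccdt l k (F :: FF) T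
| CCDT_query F FF (eta : dpath) (sub : dpath -> dtree unit) :
    l < dt_depth (cdt F) ->
    full_path F eta -> l.+1 <= size eta <= l + k ->
    (forall pi : dpath, unzip1 pi = unzip1 eta ->
       ccdt l k (restrict_list (restr_of pi) (F :: FF)) (sub pi)) ->
    ccdt l k (F :: FF) (query_all (unzip1 eta) sub).

(* The maximum of the depths of the trees in the set; they are all at most n
   ([ccdt_depth_bound], [ccdt_depth_geP]). *)
Definition ccdt_depth (l k : nat) (FF : seq cnf) : nat :=
  \max_(d < n.+1 | `[< exists2 T, ccdt l k FF T & dt_depth T = d >]) d.

Lemma cnf_value_restrict (rho : restriction) (F : cnf) x :
  cnf_value (restrict_cnf rho F) x = cnf_value F (overwrite rho x).
Proof.
rewrite /cnf_value /restrict_cnf all_map all_filter; apply: eq_all => C /=.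
have [/existsP[l /andP[lC /eqP rl]]|nsat] /= := boolP (satisfied_by rho C).
  by apply/esym/existsP; exists l; rewrite lC ffunE rl /= eqxx.
apply/existsP/existsP => -[l /andP[lC xl]]; exists l.
  by move: lC; rewrite inE ffunE => /andP[-> /eqP ->].
move: nsat; rewrite negb_exists => /forallP/(_ l); rewrite lC /=.
by move: xl; rewrite inE lC ffunE /=; case: (rho l.1) => //= b /eqP ->; rewrite eqxx.
Qed.

Definition cnf_vars (F : cnf) : {set 'I_n} := \bigcup_(C <- F) clause_vars C.

Lemma mem_cnf_vars (F : cnf) (C : clause) i :
  C \in F -> i \in clause_vars C -> i \in cnf_vars F.
Proof.
by move=> CF; apply/subsetP; rewrite /cnf_vars (big_rem C) //= subsetUl.
Qed.

Lemma restr_of_None (s : dpath) i : (restr_of s i == None) = (i \notin unzip1 s).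
Proof.
rewrite ffunE; elim: s => //= a s IHs; rewrite inE negb_or.
by case: (eqVneq a.1 i).
Qed.

Lemma cnf_vars_restrict (s : dpath) (F : cnf) :
  cnf_vars (restrict_cnf (restr_of s) F)
    \subset [set i in cnf_vars F | i \notin unzip1 s].
Proof.
rewrite {1}/cnf_vars big_seq; apply: (big_ind (fun A : {set 'I_n} => A \subset _)).
- exact: sub0set.
- by move=> A B hA hB; rewrite subUset hA.
move=> _ /mapP[C + ->]; rewrite mem_filter => /andP[_ CF].
apply/subsetP => _ /imsetP[l + ->]; rewrite !inE restr_of_None => /andP[lC ->].
by rewrite andbT (mem_cnf_vars CF)// imset_f.
Qed.

Lemma first_live_mem (F : cnf) C :
  first_live F = Some C -> (C \in F) && ~~ identically1 C.
Proof.
rewrite /first_live andbC -(mem_filter (fun C => ~~ identically1 C)).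
by case: [seq _ <- _ | _] => //= D t [->]; rewrite inE eqxx.
Qed.

Lemma live_vars (F : cnf) C : ~~ has identically0 F -> first_live F = Some C ->
  0 < #|clause_vars C| /\ clause_vars C \subset cnf_vars F.
Proof.
move=> F0 /first_live_mem /andP[CF _]; split; last first.
  by apply/subsetP => i; exact: mem_cnf_vars.
rewrite card_gt0; apply: contra F0 => /eqP C0; apply/hasP; exists C => //.
apply/forallP => x; apply/existsP => -[l /andP[lC _]].
by have := imset_f fst lC; rewrite -/(clause_vars C) C0 inE.
Qed.

Lemma card_cnf_vars_restrict (s : dpath) (F : cnf) :
  uniq (unzip1 s) -> {subset unzip1 s <= cnf_vars F} ->
  #|cnf_vars (restrict_cnf (restr_of s) F)| + size s <= #|cnf_vars F|.
Proof.
move=> us sF; have /subset_leq_card h := cnf_vars_restrict s F.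
rewrite -(cardsID [set i in unzip1 s] (cnf_vars F)) addnC leq_add //; last first.
  by apply: leq_trans h _; apply/subset_leq_card/subsetP => i; rewrite !inE andbC.
rewrite -(size_map fst) -(card_uniqP us); apply/subset_leq_card/subsetP => i si.
by rewrite !inE si sF.
Qed.

Lemma eq_query_all A vs (f g : dpath -> dtree A) :
  (forall pi, unzip1 pi = vs -> f pi = g pi) -> query_all vs f = query_all vs g.
Proof.
elim: vs f g => [|i vs IHvs] f g fg /=; first exact: fg.
by congr Query; apply: IHvs => pi pivs; apply: fg; rewrite /= pivs.
Qed.

Lemma live_segment (F : cnf) C (s : dpath) :
  ~~ has identically0 F -> first_live F = Some C ->
  unzip1 s = enum (clause_vars C) ->
  [/\ uniq (unzip1 s), {subset unzip1 s <= cnf_vars F} & 0 < size s].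
Proof.
move=> F0 FC sC; have [C0 /subsetP CF] := live_vars F0 FC.
rewrite -(size_map fst) -/(unzip1 s) sC -cardE; split=> //; first exact: enum_uniq.
by move=> i; rewrite mem_enum; apply: CF.
Qed.

Lemma cdt_rec_stable m1 m2 (F : cnf) :
  #|cnf_vars F| <= m1 -> #|cnf_vars F| <= m2 -> cdt_rec m1 F = cdt_rec m2 F.
Proof.
elim: m1 m2 F => [|m1 IHm] [|m2] F h1 h2 //=;
  case: ifPn => // F0; case FC: first_live => [C|] //.
- have [C0 /subset_leq_card CF] := live_vars F0 FC.
  by have := leq_trans C0 (leq_trans CF h1).
- have [C0 /subset_leq_card CF] := live_vars F0 FC.
  by have := leq_trans C0 (leq_trans CF h2).
apply: eq_query_all => pi piC; have [us sF s0] := live_segment F0 FC piC.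
have h := card_cnf_vars_restrict us sF.
by apply: IHm; rewrite -ltnS; [apply: leq_trans h1|apply: leq_trans h2];
  apply: leq_trans h; rewrite -addn1 leq_add2l.
Qed.

Lemma cdtE (F : cnf) :
  cdt F = if has identically0 F then Leaf false
          else if first_live F is Some C then
            query_all (enum (clause_vars C))
              (fun pi => cdt (restrict_cnf (restr_of pi) F))
          else Leaf true.
Proof.
have le_n (G : cnf) : #|cnf_vars G| <= n by rewrite -[leqRHS]card_ord max_card.
by rewrite /cdt (@cdt_rec_stable n n.+1) // (leq_trans (le_n _)).
Qed.

Lemma root_path_query_all A (sub : dpath -> dtree A) (s s' : dpath) :
  root_path (query_all (unzip1 s) sub) (s ++ s') = root_path (sub s) s'.
Proof.
elim: s sub => //= -[i b] s IHs sub; rewrite eqxx /=.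
by case: b; rewrite IHs.
Qed.

Lemma full_path_root (F : cnf) (s : dpath) : full_path F s -> root_path (cdt F) s.
Proof.
elim=> {F s} [F C s|F C s s'] F0 FC sC.
  by rewrite cdtE (negbTE F0) FC -sC -[X in root_path _ X]cats0
             root_path_query_all; case: (cdt _).
by move=> _ IH; rewrite cdtE (negbTE F0) FC -sC root_path_query_all.
Qed.

Lemma full_path_vars (F : cnf) (s : dpath) :
  full_path F s -> uniq (unzip1 s) /\ {subset unzip1 s <= cnf_vars F}.
Proof.
elim=> {F s} [F C s|F C s s'] F0 FC sC.
  by have [] := live_segment F0 FC sC.
move=> _ [us' s'F]; have [us sF _] := live_segment F0 FC sC.
have {}s'F i : i \in unzip1 s' -> (i \in cnf_vars F) && (i \notin unzip1 s).
  by move=> /s'F /(subsetP (cnf_vars_restrict s F)); rewrite inE.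
rewrite /unzip1 map_cat cat_uniq us us' andbT; split.
  by apply/hasPn => i /s'F /andP[].
by move=> i; rewrite mem_cat => /orP[/sF|/s'F/andP[]].
Qed.

Definition list_vars (FF : seq cnf) : {set 'I_n} := \bigcup_(F <- FF) cnf_vars F.

Lemma list_vars_restrict (s : dpath) (FF : seq cnf) :
  list_vars (restrict_list (restr_of s) FF)
    \subset [set i in list_vars FF | i \notin unzip1 s].
Proof.
rewrite /list_vars big_map; elim: FF => [|F FF IHF].
  by rewrite !big_nil sub0set.
rewrite !big_cons subUset; apply/andP; split; apply/subsetP => i.
  by move=> /(subsetP (cnf_vars_restrict s F)); rewrite !inE => /andP[-> ->].
by move=> /(subsetP IHF); rewrite !inE => /andP[-> ->]; rewrite orbT.
Qed.

Lemma dt_depth_query_all A vs (sub : dpath -> dtree A) m :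
  (forall pi, unzip1 pi = vs -> dt_depth (sub pi) <= m) ->
  dt_depth (query_all vs sub) <= size vs + m.
Proof.
elim: vs sub => [|i vs IHvs] sub h /=; first exact: h.
by rewrite addSn ltnS geq_max !IHvs // => pi pivs; apply: h; rewrite /= pivs.
Qed.

Lemma ccdt_depth_vars l k (FF : seq cnf) T :
  ccdt l k FF T -> dt_depth T <= #|list_vars FF|.
Proof.
elim=> {FF T} [|F FF T _ _ IH|F FF eta sub _ eF _ _ IH] //.
  apply: leq_trans IH _; apply: subset_leq_card.
  by rewrite /list_vars big_cons subsetUr.
have [ue sF] := full_path_vars eF.
set E := [set i in unzip1 eta].
have EF : E \subset list_vars (F :: FF).
  apply/subsetP => i; rewrite inE => /sF iF.
  by rewrite /list_vars big_cons inE iF.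
have sE : size (unzip1 eta) = #|E| by rewrite cardsE (card_uniqP ue).
rewrite -(subnKC (subset_leq_card EF)) -sE.
apply: dt_depth_query_all => pi pie; apply: leq_trans (IH pi pie) _.
rewrite sE -cardsDS //; apply: leq_trans (subset_leq_card (list_vars_restrict _ _)) _.
by apply/subset_leq_card/subsetP => i; rewrite !inE pie andbC.
Qed.

Lemma ccdt_depth_bound l k (FF : seq cnf) T : ccdt l k FF T -> dt_depth T <= n.
Proof.
move=> /ccdt_depth_vars h; apply: leq_trans h _.
by rewrite -[leqRHS]card_ord max_card.
Qed.

Lemma ccdt_depth_geP l k (FF : seq cnf) t : 0 < t ->
  t <= ccdt_depth l k FF <-> exists2 T, ccdt l k FF T & t <= dt_depth T.
Proof.
move=> t0; split=> [|[T FT tT]]; last first.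
  have dn : dt_depth T < n.+1 by rewrite ltnS (ccdt_depth_bound FT).
  apply: leq_trans tT _.
  by apply: (@leq_bigmax_cond _ _ _ (Ordinal dn)); apply/asboolP; exists T.
rewrite leqNgt => /negP h; apply: contrapT => nT; apply: h.
rewrite -(prednK t0) ltnS; apply/bigmax_leqP => d /asboolP[T FT dT].
rewrite -ltnS (prednK t0) ltnNge; apply/negP => td.
by apply: nT; exists T => //; rewrite dT.
Qed.

End CNF.

Definition Yq (n q : nat) : finType := ('I_n * 'I_q + 'I_n)%type.

Definition rho_of n q (w : {ffun Yq n q -> bool}) : restriction n :=
  [ffun i => if [forall j : 'I_q, w (inl (i, j))] then None else Some (w (inr i))].

Definition ceil_div (t l : nat) : nat := (t + l.-1) %/ l.

(* Main.v *)
Require Import Defs.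
From mathcomp Require Import all_boot all_order all_algebra.
From mathcomp Require Import boolp reals exp.
From mathcomp Require Import zify lra.

(* If depth(CCDT_l(F|rho)) >= t, then truncating a long path of a tree of the
   set gives t starred variables, cut into segments (one per clause queried) and
   phases (one per CDT explored), together with their values eta on the CDT
   path and pi on the CCDT path.  All phases but the last are longer than l, so
   at most ceil(t/l) formulas are involved and there are only
   M^ceil(t/l) n^O(t) such witnesses; it suffices to fool the validity of each
   of them separately.
   For a fixed witness, validity says that the first live clause of given
   formulas, under rho and given values of the earlier variables, contains given
   starred variables.  This is an AND of ORs of conditions each local to one
   clause, hence an AND-OR-AND circuit whose bottom layer (the minterms of the
   clauses) is common to the whole circuit.
   Under the uniform distribution the expected number of valid witnesses is
   bounded by Razborov's encoding: set each variable of the witness so as to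
   falsify its literal in its clause.  The clauses, which are still the first
   live ones, can then be read off one after the other, so that it is enough to
   remember the position (at most k choices) of each variable in its clause. *)

Set Implicit Arguments.
Unset Strict Implicit.
Unset Printing Implicit Defensive.

Import Order.TTheory GRing.Theory Num.Theory.

(** * Live clauses under a restriction *)

Section Live.
Variable n : nat.
Implicit Types (rho th tau : restriction n) (C : clause n) (F : cnf n).
Implicit Types (vs : seq 'I_n) (bits : seq bool).

(** The first argument has priority. In [witness_clause] it holds the path values, so that they
    still prevail once [encode] has given other values to the same variables. *)
Definition override th rho : restriction n :=
  [ffun i => if th i is Some b then Some b else rho i].

(** Speaks of the original clause, whereas [first_live] sees its restriction. The clauses of a
    witness thus remain members of the given formulas, whatever [tau] is. *)
Definition live tau C : bool := ~~ [forall x, clause_value C (overwrite tau x)].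

Definition first_live_under tau F : option (clause n) :=
  ohead [seq C <- F | live tau C].

(** [zip] truncates: only the first [size bits] variables get a value, so that the whole list of
    variables can be passed at every stage. *)
Definition assigned vs bits : restriction n := restr_of (zip vs bits).

Lemma clause_value_restrict tau C x :
  satisfied_by tau C || clause_value (restrict_clause tau C) x =
  clause_value C (overwrite tau x).
Proof.
have := cnf_value_restrict tau [:: C] x; rewrite /cnf_value /restrict_cnf /=.
by case: (satisfied_by tau C) => /=; rewrite ?andbT // => <-.
Qed.

Lemma liveE tau C :
  live tau C = ~~ satisfied_by tau C && ~~ identically1 (restrict_clause tau C).
Proof.
rewrite /live /identically1 -negb_or; congr negb.
have [sat|nsat] /= := boolP (satisfied_by tau C).
  by apply/forallP => x; rewrite -clause_value_restrict sat.
by apply: eq_forallb => x; rewrite -clause_value_restrict (negbTE nsat).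
Qed.

Lemma first_live_restrict tau F :
  first_live (restrict_cnf tau F) =
  omap (restrict_clause tau) (first_live_under tau F).
Proof.
rewrite /first_live /restrict_cnf /first_live_under.
elim: F => //= C F IHF; rewrite liveE.
by case: (satisfied_by tau C) => //=; case: (identically1 _).
Qed.

Lemma first_live_underP tau F C : first_live_under tau F = Some C ->
  [/\ C \in F, live tau C & ~~ has (live tau) (take (index C F) F)].
Proof.
rewrite /first_live_under; elim: F => //= D F IHF.
case: ifPn => /= [lD [<-]|nD /IHF[CF lC nC]]; first by rewrite mem_head eqxx.
have DC : (D == C) = false by apply: contraNF nD => /eqP ->.
by rewrite DC inE CF orbT /= (negbTE nD).
Qed.

Lemma first_live_under_some tau F C :
  C \in F -> live tau C -> ~~ has (live tau) (take (index C F) F) ->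
  first_live_under tau F = Some C.
Proof.
rewrite /first_live_under; elim: F => //= D F IHF; rewrite inE [C == D]eq_sym.
have [->|DC] /= := eqVneq D C; first by move=> _ ->.
by move=> CF lC; rewrite negb_or => /andP[/negbTE -> nC]; apply: IHF.
Qed.

Lemma first_live_under_has tau F : has (live tau) F ->
  exists C, first_live_under tau F = Some C.
Proof.
rewrite /first_live_under has_filter.
by case: [seq _ <- _ | _] => //= C s _; exists C.
Qed.

Lemma clause_vars_restrict tau C :
  clause_vars (restrict_clause tau C) = [set i in clause_vars C | tau i == None].
Proof.
apply/setP => i; rewrite !inE; apply/imsetP/andP => [[l]|[/imsetP[l lC ->] tl]].
  by rewrite inE => /andP[lC tl] ->; rewrite imset_f.
by exists l; rewrite // inE lC.
Qed.

Lemma restrict_cnf_override rho th F :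
  restrict_cnf th (restrict_cnf rho F) = restrict_cnf (override rho th) F.
Proof.
have rcC C : restrict_clause th (restrict_clause rho C) =
    restrict_clause (override rho th) C.
  apply/setP => l; rewrite !inE ffunE -andbA.
  by case: (rho l.1).
have satC C : satisfied_by (override rho th) C =
    satisfied_by rho C || satisfied_by th (restrict_clause rho C).
  apply/existsP/orP => [[l /andP[lC]]|[]/existsP[l]].
  - rewrite ffunE; case rl: (rho l.1) => [b|] h.
      by left; apply/existsP; exists l; rewrite lC rl.
    by right; apply/existsP; exists l; rewrite inE lC rl.
  - by case/andP=> lC /eqP rl; exists l; rewrite lC ffunE rl /=.
  - by rewrite inE => /andP[/andP[lC /eqP rl] tl]; exists l; rewrite lC ffunE rl.
rewrite /restrict_cnf; elim: F => //= C F IHF; rewrite satC.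
case: (satisfied_by rho C) => //=.
by case: (satisfied_by th _) => //=; rewrite rcC IHF.
Qed.

Lemma restrict_list_override rho th (FF : seq (cnf n)) :
  restrict_list th (restrict_list rho FF) = restrict_list (override rho th) FF.
Proof.
rewrite /restrict_list -map_comp; apply: eq_map => F /=.
exact: restrict_cnf_override.
Qed.

Lemma cnf_vars_restrict_star tau F i :
  i \in cnf_vars (restrict_cnf tau F) -> tau i = None.
Proof.
rewrite /cnf_vars /restrict_cnf big_map big_filter.
elim/big_rec: _ => [|C A _ IHA]; first by rewrite inE.
by rewrite inE clause_vars_restrict inE => /orP[/andP[_ /eqP]|/IHA].
Qed.

Lemma restr_of_cat (s1 s2 : dpath n) :
  restr_of (s1 ++ s2) = override (restr_of s1) (restr_of s2).
Proof.
apply/ffunP => i; rewrite !ffunE filter_cat map_cat.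
by case: [seq _ | _ <- [seq _ <- s1 | _]].
Qed.

Lemma unzip1_zip_take vs bits : unzip1 (zip vs bits) = take (size bits) vs.
Proof. by elim: vs bits => [|v vs IH] [|b bits] //=; rewrite IH. Qed.

Lemma zip_take vs bits m : size bits <= m -> zip (take m vs) bits = zip vs bits.
Proof.
elim: vs bits m => [|v vs IH] [|b bits] [|m] //= h.
by rewrite IH.
Qed.

Lemma assigned_None vs bits i :
  (assigned vs bits i == None) = (i \notin take (size bits) vs).
Proof. by rewrite restr_of_None unzip1_zip_take. Qed.

Lemma assigned_prefix vs vs' bits :
  size bits <= size vs -> assigned (vs ++ vs') bits = assigned vs bits.
Proof.
by move=> h; rewrite /assigned -(zip_take (vs ++ vs') h) take_size_cat.
Qed.

Lemma assigned_cat vs bits (s : dpath n) : size bits = size vs ->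
  assigned (vs ++ unzip1 s) (bits ++ unzip2 s) =
  override (assigned vs bits) (restr_of s).
Proof. by move=> h; rewrite /assigned zip_cat // zip_unzip restr_of_cat. Qed.

Lemma overrideAC th rho (s : dpath n) :
  (forall i, i \in unzip1 s -> rho i = None) ->
  override (override th rho) (restr_of s) = override (override th (restr_of s)) rho.
Proof.
move=> sr; have := restr_of_None s; move: (restr_of s) => tau tauN.
apply/ffunP => i; rewrite !ffunE; case: (th i) => //.
case ti: (tau i) => [b|]; last by case: (rho i).
by rewrite sr //; move: (tauN i); rewrite ti => /esym/negbFE.
Qed.

Definition extends tau tau' := forall i b, tau i = Some b -> tau' i = Some b.

Lemma live_extends tau tau' C : extends tau tau' -> live tau' C -> live tau C.
Proof.
move=> ext; apply: contra => /forallP Cv; apply/forallP => x.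
suff -> : overwrite tau' x = overwrite tau (overwrite tau' x) by apply: Cv.
by apply/ffunP => i; rewrite !ffunE; case ti: (tau i) => [b|] //=; rewrite (ext _ _ ti).
Qed.

(* [(i, false) \in C] is the value of [x_i] which falsifies the literal of [C]
   on [x_i], if there is only one. *)
Lemma live_falsify tau tau' C :
  (forall i, i \in clause_vars C ->
    tau' i = tau i \/ tau i = None /\ tau' i = Some ((i, false) \in C)) ->
  live tau C -> live tau' C.
Proof.
move=> h /forallPn[x nx]; apply/forallPn; exists x.
apply: contra nx => /existsP[[i b]] /andP[/= lC]; rewrite ffunE => xb.
have /h[tt'|[ti t'i]] : i \in clause_vars C by apply/imsetP; exists (i, b).
  by apply/existsP; exists (i, b); rewrite lC /= ffunE -tt'.
(* [(i, b)] lies in [C] and [b] is the falsifying value: this forces [b = true] with both literals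
   on x_i in [C], and one of them agrees with [x i]. *)
move: xb; rewrite t'i /= => /eqP Cb; apply/existsP.
have [xb|xb] := eqVneq (x i) b; first by exists (i, b); rewrite lC ffunE ti /= xb eqxx.
exists (i, x i); rewrite ffunE ti /= eqxx andbT.
by move: Cb lC xb; case: b; case: (x i) => // ->.
Qed.

Lemma live_local tau tau' C :
  (forall i, i \in clause_vars C -> tau i = tau' i) -> live tau C = live tau' C.
Proof.
by move=> h; apply/idP/idP; apply: live_falsify => i /h ->; left.
Qed.

End Live.

(** * Witnesses of large depth *)

Section Witness.
Variable n : nat.
Implicit Types (rho tau : restriction n) (C : clause n) (F : cnf n).
Implicit Types (pv vs : seq 'I_n) (bits th eta pi : seq bool) (idx : seq (cnf n)).

Definition entry : Type := (cnf n * seq bool)%type.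
Implicit Types (L : seq entry) (X : seq ('I_n * entry)).

(* The values eta and pi of a variable, and whether it closes no segment
   ([None]), a segment ([Some false]) or a segment and a phase ([Some true]). *)
Definition mark : Type := (bool * bool * option bool)%type.

(* For each variable of the witness, the formula of its phase and the values [th]
   given to the first [size th] variables when its segment starts.  [eta] and [pi]
   are what [th] becomes if the segment, resp. the phase, is closed. *)
Fixpoint entries idx th eta pi (zs : seq mark) : seq entry :=
  if zs is (e, p, fl) :: zs' then
    (head [::] idx, th) ::
    let eta' := rcons eta e in let pi' := rcons pi p in
    match fl with
    | None => entries idx th eta' pi' zs'
    | Some false => entries idx eta' eta' pi' zs'
    | Some true => entries (behead idx) pi' pi' pi' zs'
    end
  else [::].

(* Among the variables not yet assigned, [C] contains only those of its own
   segment: later falsifying values cannot make [C] true. *)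
Definition separated vs X (x : 'I_n * entry) C : bool :=
  all (fun y => (y.1 \notin take (size x.2.2) vs) && (y.1 \in clause_vars C)
                ==> (y.2 == x.2)) X.

Definition witness_clause vs rho (a : entry) : option (clause n) :=
  first_live_under (override (assigned vs a.2) rho) a.1.

(** Mentions no decision tree, only first live clauses: this makes it testable by a small circuit
    and reversible by the encoding. *)
Definition valid vs X rho : bool :=
  [&& uniq vs, all (fun x => rho x.1 == None) X &
    all (fun x => if witness_clause vs rho x.2 is Some C then
                    (x.1 \in clause_vars C) && separated vs X x C
                  else false) X].

Lemma size_entries idx th eta pi zs : size (entries idx th eta pi zs) = size zs.
Proof.
by elim: zs idx th eta pi => //= -[[e p] [[]|]] zs IH idx th eta pi /=; rewrite IH.
Qed.

Lemma entries_size_ge idx th eta pi zs a : size eta = size pi ->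
  size th <= size eta -> a \in entries idx th eta pi zs -> size th <= size a.2.
Proof.
elim: zs idx th eta pi => //= -[[e p] fl] zs IH idx th eta pi ep te.
rewrite inE => /orP[/eqP-> //|].
case: fl => [[]|] /IH; rewrite !size_rcons ?ep => h.
- by apply: leq_trans (h _ _) => //; rewrite -ep; apply: leqW.
- by apply: leq_trans (h _ _) => //; rewrite -ep; apply: leqW.
- by apply: h => //; rewrite -ep; apply: leqW.
Qed.

(** With empty initial values, the m-th entry assigns at most the first [m] variables. Decoding can
    therefore recover the variables one after the other. *)
Lemma entries_size_le idx th eta pi zs m : size eta = size pi ->
  size th <= size eta -> m < size zs ->
  size (nth ([::], [::]) (entries idx th eta pi zs) m).2 <= size eta + m.
Proof.
elim: zs idx th eta pi m => //= -[[e p] fl] zs IH idx th eta pi [|m] ep te /=.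
  by rewrite addn0.
rewrite ltnS addnS -addSn -(size_rcons eta e) => mz.
have ep' : size (rcons eta e) = size (rcons pi p) by rewrite !size_rcons ep.
case: fl => [[]|].
- by rewrite ep'; apply: IH.
- exact: IH.
- by apply: IH; rewrite // size_rcons leqW.
Qed.

(** The empty formula is the default of [head]: arbitrary marks may close more phases than [idx] has
    formulas. *)
Lemma entries_mem idx th eta pi zs a :
  a \in entries idx th eta pi zs -> (a.1 \in idx) || (a.1 == [::]).
Proof.
elim: zs idx th eta pi => //= -[[e p] fl] zs IH idx th eta pi.
rewrite inE => /orP[/eqP-> /=|].
  by case: idx => [|F idx]; rewrite //= mem_head.
by case: fl => [[]|] /IH //; case/orP=> [/mem_behead ->|->]; rewrite ?orbT.
Qed.

Fixpoint segment_marks fl (es ps : seq bool) : seq mark :=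
  match es, ps with
  | e :: es', p :: ps' =>
      (e, p, if es' is [::] then Some fl else None) :: segment_marks fl es' ps'
  | _, _ => [::]
  end.

Lemma size_segment_marks fl es ps : size es = size ps ->
  size (segment_marks fl es ps) = size es.
Proof. by elim: es ps => [|e es IH] [|p ps] //= [/IH ->]. Qed.

Lemma entries_segment idx th eta pi fl es ps zs : size es = size ps -> 0 < size es ->
  entries idx th eta pi (segment_marks fl es ps ++ zs) =
  nseq (size es) (head [::] idx, th) ++
  (if fl then entries (behead idx) (pi ++ ps) (pi ++ ps) (pi ++ ps) zs
   else entries idx (eta ++ es) (eta ++ es) (pi ++ ps) zs).
Proof.
elim: es eta pi ps => [|e es IH] eta pi [|p ps] //= [sep] _.
case: es ps sep IH => [|e' es] [|p' ps] // sep IH.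
  by rewrite /= !cats1; case: (fl).
by rewrite IH // !cat_rcons.
Qed.

(** A witness is cut at a prescribed length, possibly inside a segment. Marks that close nothing
    leave the entry unchanged, so their values are dummies. *)
Lemma entries_truncated idx th eta pi r :
  entries idx th eta pi (nseq r (false, false, None)) = nseq r (head [::] idx, th).
Proof. by elim: r eta pi => //= r IH eta pi; rewrite IH. Qed.

Lemma valid_segment rho pv F th w X C : size th = size pv ->
  first_live_under (override (assigned pv th) rho) F = Some C ->
  {subset w <= clause_vars C} -> (forall i, i \in w -> rho i = None) ->
  valid (pv ++ w ++ unzip1 X) X rho ->
  (forall x, x \in X -> size pv + size w <= size x.2.2) ->
  (forall i, i \in clause_vars C -> rho i = None -> i \notin pv -> i \notin w ->
     i \notin unzip1 X) ->
  valid (pv ++ w ++ unzip1 X) ([seq (v, (F, th)) | v <- w] ++ X) rho.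
Proof.
move=> sth FC wC wr /and3P[uv Xr vX] sX CX; apply/and3P; split=> //.
  by rewrite all_cat Xr andbT all_map; apply/allP => i /wr /= ->.
set vs := pv ++ w ++ unzip1 X; rewrite -/vs in uv vX *.
have wX : {in unzip1 X, forall i, i \notin w}.
  by move: uv; rewrite /vs !cat_uniq => /and3P[_ _ /and3P[_ /hasPn h _]].
rewrite all_cat; apply/andP; split.
  rewrite all_map; apply/allP => i iw /=.
  rewrite /witness_clause /= assigned_prefix ?sth // FC (wC i) //=.
  rewrite /separated all_cat all_map; apply/andP; split.
    by apply/allP => j _ /=; rewrite eqxx implybT.
  apply/allP => x xX /=; rewrite sth take_size_cat //.
  apply/implyP => /andP[xpv xC].
  have xu : x.1 \in unzip1 X by apply: map_f.
  by have := CX _ xC (eqP (allP Xr _ xX)) xpv (wX _ xu); rewrite xu.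
apply/allP => x xX; have := allP vX _ xX.
case: (witness_clause _ _ _) => // D /andP[-> sepX] /=.
rewrite /separated all_cat [all _ X]sepX andbT all_map; apply/allP => i iw /=.
suff -> : i \in take (size x.2.2) vs by [].
by rewrite /vs catA take_cat size_cat ltnNge sX //= !mem_cat iw orbT.
Qed.

(** State at the start of a segment: [pv] has been queried, [th] steers the CDT of the current
    phase, [pi] follows the CCDT path. At that moment eta coincides with [th], hence the repeated
    argument. *)
Definition traceable rho pv idx th pi r : Prop :=
  exists vs zs, [/\ size vs = r, size zs = r &
    valid (pv ++ vs) (zip vs (entries idx th th pi zs)) rho].

Lemma zip_nseq (A B : Type) (s : seq A) (b : B) :
  zip s (nseq (size s) b) = [seq (a, b) | a <- s].
Proof. by elim: s => //= a s ->. Qed.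

(** [s] carries the values on the CDT path and [s'] those on the CCDT path. Inside a phase the next
    clause is found with the values of [s]; closing the phase ([fl]) discards the CDT values in
    favour of the CCDT ones. *)
Lemma traceable_segment rho pv F idx th pi D (s s' : dpath n) fl r :
  size th = size pv -> size pi = size pv -> uniq pv ->
  first_live (restrict_cnf (override (assigned pv th) rho) F) = Some D ->
  unzip1 s = enum (clause_vars D) -> unzip1 s' = unzip1 s -> 0 < size s ->
  (size s < r ->
     traceable rho (pv ++ unzip1 s) (if fl then idx else F :: idx)
       (if fl then pi ++ unzip2 s' else th ++ unzip2 s) (pi ++ unzip2 s')
       (r - size s)) ->
  traceable rho pv (F :: idx) th pi r.
Proof.
move=> sth spi upv; rewrite first_live_restrict.
case FC: first_live_under => [C|] //= -[CD] sD ss' s0 next.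
have sP i : (i \in unzip1 s) =
    [&& i \in clause_vars C, rho i == None & i \notin pv].
  rewrite sD mem_enum -CD clause_vars_restrict inE; congr (_ && _).
  have := assigned_None pv th i; rewrite sth take_size [override _ _ i]ffunE.
  by case: (assigned pv th i) => [b|] <-; rewrite ?andbF ?andbT.
have us : uniq (unzip1 s) by rewrite sD enum_uniq.
have sz : size (unzip1 s) = size s by rewrite size_map.
have sz' : size s' = size s by rewrite -sz -ss' size_map.
have [rs|sr] := leqP r (size s).
  exists (take r (unzip1 s)), (nseq r (false, false, None)).
  have st : size (take r (unzip1 s)) = r by rewrite size_takel // sz.
  split; rewrite ?size_nseq // entries_truncated -[in nseq _ _]st zip_nseq /=.
  have := @valid_segment rho pv F th (take r (unzip1 s)) [::] C sth FC.
  rewrite !cats0; apply=> //.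
  - by move=> i /mem_take; rewrite sP => /and3P[].
  - by move=> i /mem_take; rewrite sP => /and3P[_ /eqP].
  rewrite /valid !andbT cat_uniq upv take_uniq // andbT.
  by apply/hasPn => i /mem_take; rewrite sP => /and3P[].
have [vs [zs [svs szs]]] := next sr; set L := entries _ _ _ _ zs => vX.
exists (unzip1 s ++ vs), (segment_marks fl (unzip2 s) (unzip2 s') ++ zs).
have se : size (unzip2 s) = size (unzip2 s') by rewrite !size_map.
have sL : size vs = size L by rewrite size_entries svs.
split; first by rewrite size_cat sz svs subnKC // ltnW.
  by rewrite size_cat size_segment_marks // size_map szs subnKC // ltnW.
rewrite entries_segment //; last by rewrite size_map.
have -> : (if fl then entries (behead (F :: idx)) (pi ++ unzip2 s')
               (pi ++ unzip2 s') (pi ++ unzip2 s') zs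
           else entries (F :: idx) (th ++ unzip2 s) (th ++ unzip2 s)
               (pi ++ unzip2 s') zs) = L by rewrite /L; case: (fl).
rewrite zip_cat ?size_nseq ?size_map // -sz zip_nseq /=.
set X := zip vs L; have Xvs : unzip1 X = vs by rewrite unzip1_zip // sL.
rewrite -[in pv ++ _]Xvs.
have uvs : uniq ((pv ++ unzip1 s) ++ vs) by case/and3P: vX.
apply: (valid_segment sth FC) => [i|i||x xX|i iC ri ip].
- by rewrite sP => /and3P[].
- by rewrite sP => /and3P[_ /eqP].
- by rewrite Xvs catA.
- have xL : x.2 \in L by rewrite -(@unzip2_zip _ _ vs L) ?sL // map_f.
  rewrite sz; move: xL; rewrite /L.
  have sw1 : size (pi ++ unzip2 s') = size pv + size s.
    by rewrite size_cat size_map spi sz'.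
  have sw2 : size (th ++ unzip2 s) = size pv + size s.
    by rewrite size_cat size_map sth.
  by case: (fl) => /entries_size_ge; rewrite ?sw1 ?sw2; apply.
- by rewrite sP iC ri ip.
Qed.

Lemma traceable_phase rho idx F0 (eta : dpath n) : full_path F0 eta ->
  forall F pv th pi (s : dpath n) r,
    F0 = restrict_cnf (override (assigned pv th) rho) F ->
    size th = size pv -> size pi = size pv -> uniq pv -> unzip1 s = unzip1 eta ->
    (size eta < r -> traceable rho (pv ++ unzip1 eta) idx (pi ++ unzip2 s)
                       (pi ++ unzip2 s) (r - size eta)) ->
    traceable rho pv (F :: idx) th pi r.
Proof.
elim=> {F0 eta} [F0 D eta|F0 D eta eta'] F00 FD etaD.
  move=> F pv th pi s r F0E sth spi upv seta next; subst F0.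
  have [_ _ s0] := live_segment F00 FD etaD.
  by apply: (traceable_segment (fl := true) sth spi upv FD etaD seta s0).
move=> _ IH F pv th pi s r F0E sth spi upv seta next; subst F0.
have [ue esub s0] := live_segment F00 FD etaD.
have star i : i \in unzip1 eta -> override (assigned pv th) rho i = None.
  by move=> /esub /cnf_vars_restrict_star.
have starr i : i \in unzip1 eta -> rho i = None.
  by move=> /star; rewrite ffunE; case: (assigned _ _ _).
have starp i : i \in unzip1 eta -> i \notin pv.
  move=> /star; rewrite ffunE -[pv in _ \notin pv]take_size -sth -assigned_None.
  by case: (assigned _ _ _).
have sz : size s = size eta + size eta'.
  by rewrite -(size_map fst) -/(unzip1 s) seta size_map size_cat.
have s1 : unzip1 (take (size eta) s) = unzip1 eta.
  by rewrite /unzip1 map_take -/(unzip1 s) seta /unzip1 map_cat take_size_cat ?size_map.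
have s2 : unzip1 (drop (size eta) s) = unzip1 eta'.
  by rewrite /unzip1 map_drop -/(unzip1 s) seta /unzip1 map_cat drop_size_cat ?size_map.
apply: (traceable_segment (fl := false) sth spi upv FD etaD s1 s0) => er.
apply: (IH F _ _ _ (drop (size eta) s)) => //.
(* The segment sets only stars of [rho], so its values may be moved in front of [rho]. *)
- by rewrite assigned_cat // restrict_cnf_override overrideAC.
- by rewrite !size_cat !size_map sth.
- by rewrite !size_cat !size_map spi size_takel // sz leq_addr.
- by rewrite cat_uniq upv ue andbT; apply/hasPn => i /starp.
move=> er'; rewrite -!catA -[unzip1 eta ++ _]map_cat -[_ ++ unzip2 (drop _ _)]map_cat.
rewrite cat_take_drop -subnDA -size_cat; apply: next.
by rewrite size_cat -ltn_subRL.
Qed.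

Lemma dt_depth_query_all_path A vs (sub : dpath n -> dtree n A) m :
  size vs + m < dt_depth (query_all vs sub) ->
  exists2 s : dpath n, unzip1 s = vs & m < dt_depth (sub s).
Proof.
move=> h; apply: contrapT => ns; move: h; rewrite ltnNge => /negP; apply.
apply: dt_depth_query_all => s svs; rewrite leqNgt; apply/negP => ms.
by apply: ns; exists s.
Qed.

(** A phase explored to its end uses more than [l] variables, which is why [c] formulas suffice for
    [r <= c * l] variables. At each phase the branch [s] is chosen deep enough for the remaining
    length. *)
Lemma ccdt_traceable rho l k G T : 0 < l -> ccdt l k G T ->
  forall FF pv pi r c,
    G = restrict_list (override (assigned pv pi) rho) FF ->
    size pi = size pv -> uniq pv -> 0 < r <= dt_depth T -> r <= c * l ->
    exists idx, [/\ size idx = c, {subset idx <= FF} & traceable rho pv idx pi pi r].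
Proof.
move=> l0; elim=> {G T} [|F0 FF0 T _ _ IH|F0 FF0 eta sub _ Feta /andP[leta _] _ IH]
  FF pv pi r c.
- by move=> _ _ _ /andP[r0 /(leq_trans r0)].
- case: FF => //= F FF [_ FFE] spi upv rT rc.
  have [idx [sidx sub ti]] := IH FF pv pi r c FFE spi upv rT rc.
  by exists idx; split=> // H /sub HF; rewrite inE HF orbT.
case: FF => //= F FF [F0E FFE] spi upv /andP[r0 rT].
case: c => [|c]; first by rewrite mul0n leqNgt r0.
move=> rc; have sz : size (unzip1 eta) = size eta by rewrite size_map.
have [re|er] := leqP r (size eta).
  (* The witness ends within this phase; the copies of [F] after the first only pad [idx] to the
     required length. *)
  exists (nseq c.+1 F); split; first exact: size_nseq.
    by move=> H; rewrite mem_nseq => /andP[_ /eqP ->]; exact: mem_head.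
  apply: (traceable_phase Feta F0E spi spi upv (erefl (unzip1 eta))).
  by rewrite ltnNge re.
have [|s seta rs] := @dt_depth_query_all_path _ (unzip1 eta) sub (r - size eta).-1.
  by rewrite sz -addnS prednK ?subn_gt0 // subnKC // ltnW.
rewrite prednK ?subn_gt0 // in rs.
have [ue esub] := full_path_vars Feta.
have star i : i \in unzip1 eta -> override (assigned pv pi) rho i = None.
  by rewrite F0E in esub; move=> /esub /cnf_vars_restrict_star.
have starr i : i \in unzip1 eta -> rho i = None.
  by move=> /star; rewrite ffunE; case: (assigned _ _ _).
have starp i : i \in unzip1 eta -> i \notin pv.
  move=> /star; rewrite ffunE -[pv in _ \notin pv]take_size -spi -assigned_None.
  by case: (assigned _ _ _).
have [|||||idx [sidx idxF ti]] :=
  IH s seta (F :: FF) (pv ++ unzip1 eta) (pi ++ unzip2 s) (r - size eta) c.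
- rewrite -seta assigned_cat // -overrideAC ?seta // -restrict_list_override.
  by rewrite F0E FFE.
- by rewrite !size_cat !size_map spi -sz -seta size_map.
- by rewrite cat_uniq upv ue andbT; apply/hasPn => i /starp.
- by rewrite subn_gt0 er.
- by rewrite leq_subLR (leq_trans rc) // mulSn leq_add2r ltnW.
exists (F :: idx); split; first by rewrite /= sidx.
  by move=> H; rewrite inE => /orP[/eqP->|/idxF//]; exact: mem_head.
by apply: (traceable_phase Feta F0E spi spi upv seta).
Qed.

(** A nontrivial tree begins with a path of more than [l] distinct variables. With [l] positive this
    gives n >= 2, so powers of n can absorb constants. *)
Lemma ccdt_depth_gt0 l k (G : seq (cnf n)) T :
  ccdt l k G T -> 0 < dt_depth T -> l < n.
Proof.
elim=> {G T} // F FF eta sub _ /full_path_vars[ue _] /andP[le _] _ _ _.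
apply: leq_trans le _; rewrite -(size_map fst) -[leqRHS]card_ord.
by rewrite -(card_uniqP ue) max_card.
Qed.

Lemma ccdt_depth_witness l k (FF : seq (cnf n)) rho t : 0 < l -> 0 < t ->
  t <= ccdt_depth l k (restrict_list rho FF) ->
  l < n /\ exists vs zs idx, [/\ size vs = t, size zs = t, size idx = ceil_div t l,
    {subset idx <= FF} & valid vs (zip vs (entries idx [::] [::] [::] zs)) rho].
Proof.
move=> l0 t0 /ccdt_depth_geP-/(_ t0)[T FT tT]; split.
  exact: ccdt_depth_gt0 FT (leq_trans t0 tT).
have [|||||idx [sidx idxF [vs [zs [svs szs v]]]]] :=
  ccdt_traceable (rho := rho) l0 FT (FF := FF) (pv := [::]) (pi := [::])
    (r := t) (c := ceil_div t l) => //.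
- congr restrict_list; apply/ffunP => i; rewrite ffunE.
  by have /eqP -> : assigned [::] [::] i == None :> option bool by rewrite assigned_None.
- by rewrite t0.
- rewrite /ceil_div; have := divn_eq (t + l.-1) l; have := ltn_pmod (t + l.-1) l0.
  rewrite -(ltn_add2l ((t + l.-1) %/ l * l)) => h e; rewrite -e in h.
  by rewrite -(leq_add2r l.-1) -ltnS -[ltnRHS]addnS (prednK l0).
by exists vs, zs, idx; split.
Qed.

End Witness.

(** * Fibers of the restriction map *)

Section Fibers.
Variables (n q : nat).
Implicit Types (rho : restriction n) (w : {ffun Yq n q -> bool}).

Definition fiber rho : {set {ffun Yq n q -> bool}} := [set w | rho_of w == rho].

Definition set_star rho (v : 'I_n) (b : bool) : restriction n :=
  [ffun i => if i == v then Some b else rho i].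

(** Injection: from a point of the fiber and a block [u] of q bits not all 1, put [u] and [b] at [v]
    and record the old bit y_v, whence the factor 2. The old block is not recorded, as it is all
    1. *)
Lemma card_fiber_set_star rho v b : rho v = None ->
  #|fiber rho| * (2 ^ q).-1 <= 2 * #|fiber (set_star rho v b)|.
Proof.
move=> rv.
pose U := [set~ [ffun=> true] : {ffun 'I_q -> bool}].
have cU : #|U| = (2 ^ q).-1 by rewrite cardsC1 card_ffun card_bool card_ord.
pose upd w (u : {ffun 'I_q -> bool}) (c : bool) : {ffun Yq n q -> bool} :=
  [ffun y => match y with
             | inl (i, j) => if i == v then u j else w (inl (i, j))
             | inr i => if i == v then c else w (inr i)
             end].
pose f (x : {ffun Yq n q -> bool} * {ffun 'I_q -> bool}) :=
  (x.1 (inr v), upd x.1 x.2 b).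
rewrite -cU -cardsX -card_bool -cardsT -cardsX.
have finj : {in setX (fiber rho) U &, injective f}.
  move=> [w1 u1] [w2 u2]; rewrite !inE /= => /andP[/eqP r1 _] /andP[/eqP r2 _].
  case=> wv uw; have uwE y : upd w1 u1 b y = upd w2 u2 b y by rewrite uw.
  congr (_, _); last first.
    by apply/ffunP => j; have := uwE (inl (v, j)); rewrite !ffunE eqxx.
  have one w j : rho_of w = rho -> w (inl (v, j)).
    by move=> rw; move: rv; rewrite -rw ffunE; case: ifP => // /forallP.
  apply/ffunP => -[[i j]|i].
    have [->|iv] := eqVneq i v; first by rewrite !one.
    by have := uwE (inl (i, j)); rewrite !ffunE (negbTE iv).
  have [->|iv] := eqVneq i v; first exact: wv.
  by have := uwE (inr i); rewrite !ffunE (negbTE iv).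
rewrite -(card_in_imset finj); apply/subset_leq_card/subsetP => y /imsetP[[w u]].
rewrite in_setX in_setC1 inE /= => /andP[/eqP rw ut] ->; rewrite in_setX in_setT inE /=.
apply/eqP/ffunP => i; rewrite !ffunE.
have [->|iv] := eqVneq i v.
  case: ifP => // /forallP h; case/negP: ut.
  by apply/eqP/ffunP => j; have := h j; rewrite !ffunE eqxx.
rewrite -rw ffunE; congr (if _ then _ else _).
by apply: eq_forallb => j; rewrite ffunE (negbTE iv).
Qed.

Definition set_stars rho (vs : seq 'I_n) (b : 'I_n -> bool) : restriction n :=
  [ffun i => if i \in vs then Some (b i) else rho i].

Lemma card_fiber_set_stars rho vs b :
  uniq vs -> all (fun v => rho v == None) vs ->
  #|fiber rho| * (2 ^ q).-1 ^ size vs <=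
  2 ^ size vs * #|fiber (set_stars rho vs b)|.
Proof.
elim: vs => [|v vs IH] /=.
  move=> _ _; rewrite muln1 mul1n.
  by have -> : set_stars rho [::] b = rho by apply/ffunP => i; rewrite ffunE.
case/andP=> vvs uvs /andP[/eqP rv rvs].
have -> : set_stars rho (v :: vs) b = set_star (set_stars rho vs b) v (b v).
  by apply/ffunP => i; rewrite !ffunE inE; case: eqP => [->|].
rewrite !expnS mulnCA mulnC -mulnA.
apply: leq_trans (_ : (2 ^ size vs * #|fiber (set_stars rho vs b)|) * (2 ^ q).-1 <= _).
  by rewrite mulnA leq_mul2r IH ?orbT.
rewrite -mulnA [2 * _]mulnC -!mulnA leq_mul2l; apply/orP; right.
by apply: card_fiber_set_star; rewrite ffunE (negbTE vvs).
Qed.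

End Fibers.

(** * Razborov's encoding *)

Section Encoding.
Variables (n q k t : nat) (L : seq (entry n)).
Hypothesis size_L : size L = t.
Local Notation e := (nth ([::], [::]) L).
Hypothesis bits_L : forall m, m < t -> size (e m).2 <= m.
Hypothesis width_L : forall a, a \in L -> forall C, C \in a.1 -> #|C| <= k.+1.
Implicit Types (rho : restriction n) (vs : t.-tuple 'I_n) (C : clause n).

Definition clause_at vs rho m : clause n := odflt set0 (witness_clause vs rho (e m)).

Lemma valid_nth vs rho m v0 : valid vs (zip vs L) rho -> m < t ->
  exists C, [/\ witness_clause vs rho (e m) = Some C, nth v0 vs m \in clause_vars C &
    forall m', m' < t -> size (e m).2 <= m' -> nth v0 vs m' \in clause_vars C ->
      e m' = e m].
Proof.
case/and3P=> uvs _ /allP h mt; have szL : size vs = size L by rewrite size_tuple size_L.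
have zipP m' : m' < t -> (nth v0 vs m', e m') \in zip vs L.
  move=> m't; rewrite -(nth_zip v0 ([::], [::])) // mem_nth //.
  by rewrite size_zip -szL minnn size_tuple.
have /= := h _ (zipP m mt); case: (witness_clause _ _ _) => // C /andP[vC /allP sC].
exists C; split=> // m' m't mm' vC'.
have /= := sC _ (zipP m' m't); rewrite vC' andbT in_take; last first.
  by rewrite mem_nth // size_tuple.
by rewrite index_uniq ?size_tuple // -leqNgt mm' => /eqP.
Qed.

Definition encode vs rho : restriction n :=
  set_stars rho vs (fun i => (i, false) \in clause_at vs rho (index i vs)).

Lemma valid_star vs rho i : valid vs (zip vs L) rho -> i \in vs -> rho i = None.
Proof.
case/and3P=> _ /allP h _ ivs; apply/eqP.
have szL : size vs = size L by rewrite size_tuple size_L.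
have : i \in unzip1 (zip vs L) by rewrite unzip1_zip // szL.
by case/mapP=> x /h rx ->.
Qed.

(** By separation, the witness variables of this clause not yet assigned share its entry, so they
    are set to falsify that very clause, which stays live. The clauses before it stay non-live since
    [encode] only fixes more variables. *)
Lemma encode_clause vs rho m : valid vs (zip vs L) rho -> m < t ->
  witness_clause vs (encode vs rho) (e m) = Some (clause_at vs rho m).
Proof.
move=> v mt; have v0 : 'I_n by exact: (tnth vs (Ordinal mt)).
have [C [FC _ sC]] := valid_nth v0 v mt.
have CE : clause_at vs rho m = C by rewrite /clause_at FC.
rewrite CE; have [CF lC nC] := first_live_underP FC.
apply: first_live_under_some => //.
  apply: live_falsify lC => i iC; rewrite ![override _ _ _]ffunE.
  have := assigned_None vs (e m).2 i; case: (assigned _ _ i) => [b|]; first by left.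
  move=> /esym; rewrite eqxx => ntake; rewrite [encode _ _ _]ffunE.
  case: ifPn => ivs; last by left.
  right; split; first exact: valid_star v ivs.
  rewrite in_take // -leqNgt in ntake.
  have it : index i vs < t by rewrite -[ltnRHS](size_tuple vs) index_mem.
  have ei : e (index i vs) = e m by apply: sC; rewrite ?nth_index.
  by rewrite /clause_at ei FC.
apply: contra nC; apply: sub_has => D; apply: live_extends => i b.
rewrite ![override _ _ _]ffunE; case: (assigned _ _ i) => // ri.
by rewrite [encode _ _ _]ffunE; case: ifPn => // /(valid_star v); rewrite ri.
Qed.

(** [inord] needs a nonempty ordinal, hence the width bound [k.+1], later used at [k.-1]. *)
Definition positions vs rho : {ffun 'I_t -> 'I_k.+1} :=
  [ffun m => inord (index (tnth vs m) (enum (clause_vars (clause_at vs rho m))))].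

(** Induction on prefixes: equal first variables give equal [assigned] values at the m-th entry of
    the common [L], then [encode_clause] yields the same clause and the position the same variable.
    Once the variables agree, the restrictions are recovered by restoring their stars. *)
Lemma encode_inj vs1 vs2 rho1 rho2 :
  valid vs1 (zip vs1 L) rho1 -> valid vs2 (zip vs2 L) rho2 ->
  positions vs1 rho1 = positions vs2 rho2 -> encode vs1 rho1 = encode vs2 rho2 ->
  (vs1, rho1) = (vs2, rho2).
Proof.
move=> v1 v2 pos enc.
suff vs12 : vs1 = vs2.
  rewrite vs12; congr (_, _); subst vs2; apply/ffunP => i.
  have [ivs|ivs] := boolP (i \in vs1); first by rewrite !(valid_star _ ivs).
  by move/ffunP/(_ i): enc; rewrite !ffunE (negbTE ivs).
have tE m : m <= t -> take m vs1 = take m vs2.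
  elim: m => [|m IH] mt; first by rewrite !take0.
  have v0 : 'I_n by exact: (tnth vs1 (Ordinal mt)).
  rewrite !(take_nth v0) ?size_tuple // IH ?(ltnW mt) //; congr rcons.
  have [C1 [FC1 C1v _]] := valid_nth v0 v1 mt.
  have [C2 [FC2 C2v _]] := valid_nth v0 v2 mt.
  have E1 : clause_at vs1 rho1 m = C1 by rewrite /clause_at FC1.
  have E2 : clause_at vs2 rho2 m = C2 by rewrite /clause_at FC2.
  have aE : assigned vs1 (e m).2 = assigned vs2 (e m).2.
    by rewrite /assigned -(zip_take vs1 (bits_L mt)) IH ?zip_take ?bits_L // ltnW.
  have C12 : C1 = C2.
    have := encode_clause v1 mt; have := encode_clause v2 mt.
    by rewrite /witness_clause E1 E2 aE enc => -> [].
  move/ffunP/(_ (Ordinal mt)): pos; rewrite !ffunE /= E1 E2 -C12.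
  rewrite !(tnth_nth v0) /= => /(congr1 (@nat_of_ord _)).
  have lt v : v \in clause_vars C1 -> index v (enum (clause_vars C1)) < k.+1.
    move=> vC; apply: (@leq_trans #|clause_vars C1|).
      by rewrite cardE index_mem mem_enum.
    apply: leq_trans (leq_imset_card _ _) _.
    have [CF _ _] := first_live_underP FC1.
    by apply: width_L CF; rewrite mem_nth // size_L.
  rewrite !inordK ?lt //; last by rewrite C12.
  move/(congr1 (nth v0 (enum (clause_vars C1)))).
  by rewrite !nth_index ?mem_enum //; rewrite C12.
apply/val_inj; rewrite /= -[tval vs1]take_size -[tval vs2]take_size !size_tuple.
exact: tE.
Qed.

(** Encoding a valid pair multiplies its fiber by at least ((2^q - 1) / 2)^t. By injectivity the new
    fibers are, for each of the (k + 1)^t position vectors, disjoint parts of the whole cube. *)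
Lemma sum_card_valid :
  (\sum_(vs : t.-tuple 'I_n)
     #|[set w : {ffun Yq n q -> bool} | valid vs (zip vs L) (rho_of w)]|) *
    (2 ^ q).-1 ^ t <= (2 * k.+1) ^ t * 2 ^ #|Yq n q|.
Proof.
have cardE vs : #|[set w : {ffun Yq n q -> bool} | valid vs (zip vs L) (rho_of w)]| =
    \sum_(rho | valid vs (zip vs L) rho) #|fiber q rho|.
  rewrite -sum1dep_card (partition_big (@rho_of n q) (valid vs (zip vs L))) //=.
  apply: eq_bigr => rho vr; rewrite -sum1dep_card; apply: eq_bigl => w.
  by case: eqP => [->|]; rewrite ?vr ?andbF.
under eq_bigr do rewrite cardE.
rewrite pair_big_dep /= big_distrl /=.
pose A := [set x : t.-tuple 'I_n * restriction n | valid x.1 (zip x.1 L) x.2].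
pose f (x : t.-tuple 'I_n * restriction n) := (positions x.1 x.2, encode x.1 x.2).
have finj : {in A &, injective f}.
  move=> [vs1 r1] [vs2 r2]; rewrite !inE /= => v1 v2 [p12 e12].
  exact: encode_inj.
apply: (@leq_trans (\sum_(x in A) 2 ^ t * #|fiber q (f x).2|)).
  under [leqRHS]eq_bigl do rewrite inE.
  apply: leq_sum => -[vs rho] /= v; rewrite -{1 2}(size_tuple vs).
  apply: card_fiber_set_stars; first by case/and3P: v.
  by apply/allP => i /(valid_star v) ->.
rewrite -(big_imset (fun y => 2 ^ t * #|fiber q y.2|)) //=.
apply: (@leq_trans (\sum_(y : {ffun 'I_t -> 'I_k.+1} * restriction n)
                      2 ^ t * #|fiber q y.2|)).
  by rewrite [leqRHS](bigID (mem (f @: A))) /= leq_addr.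
rewrite -big_distrr /= expnMn -mulnA leq_mul2l; apply/orP; right.
rewrite -(pair_bigA _ (fun _ rho => #|fiber q rho|)) /= sum_nat_const card_ffun.
rewrite !card_ord leq_mul2l; apply/orP; right.
rewrite -[2 in leqRHS]card_bool -card_ffun -sum1_card.
rewrite (partition_big (@rho_of n q) predT) //=; apply: leq_sum => rho _.
by rewrite -sum1dep_card.
Qed.

End Encoding.

(** * AND-OR-AND circuits *)

Section AndOrAnd.
Variable V : finType.
Local Notation term := (seq (V * bool)).
Implicit Types (x : {ffun V -> bool}) (T : term) (Bs : seq term) (Ms : seq (seq term)).
Implicit Types (c : circuit V).

Definition term_value x T : bool := all (fun l => x l.1 == l.2) T.

Lemma gate_values_rcons x c g :
  gate_values x (rcons c g) = rcons (gate_values x c) (gate_value x (gate_values x c) g).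
Proof. by rewrite /gate_values foldl_rcons. Qed.

Lemma gate_depths_rcons c g :
  gate_depths (rcons c g) =
  rcons (gate_depths c) (\max_(w <- inputs g) wire_depth (gate_depths c) w).+1.
Proof. by rewrite /gate_depths foldl_rcons. Qed.

Lemma gates_ok_rcons j c g :
  gates_ok j (rcons c g) = gates_ok j c && all (wire_ok (j + size c)) (inputs g).
Proof.
elim: c j => [|h c IH] j /=; first by rewrite addn0 andbT.
by rewrite IH addnS -addSn andbA.
Qed.

Definition bottom_gate T : gate V := Gate true [seq inl l | l <- T].
Definition middle_gate Bs (m : seq term) : gate V :=
  Gate false [seq inr (index T Bs) | T <- m].
Definition top_gate (Ls : term) (a b : nat) : gate V :=
  Gate true ([seq inl l | l <- Ls] ++ [seq inr i | i <- iota a b]).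

(** The literals [Ls] feed the top gate directly and cost no gate; middle gates find their terms by
    index in [Bs], so equal terms share one gate. *)
Definition and_or_and Bs Ms Ls : circuit V :=
  rcons ([seq bottom_gate T | T <- Bs] ++ [seq middle_gate Bs m | m <- Ms])
        (top_gate Ls (size Bs) (size Ms)).

Lemma bottom_values x Bs :
  gate_values x [seq bottom_gate T | T <- Bs] = [seq term_value x T | T <- Bs].
Proof.
elim/last_ind: Bs => // Bs T IH; rewrite !map_rcons gate_values_rcons IH.
by rewrite /gate_value /= all_map.
Qed.

Lemma bottom_depths Bs :
  gate_depths [seq bottom_gate T | T <- Bs] = nseq (size Bs) 1.
Proof.
elim/last_ind: Bs => // Bs T IH; rewrite map_rcons gate_depths_rcons IH size_rcons.
rewrite [inputs _]/= big_map big1 //= -cats1; elim: (size Bs) => //= s ->.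
by [].
Qed.

Lemma bottom_ok Bs : gates_ok 0 [seq bottom_gate T | T <- Bs].
Proof.
elim/last_ind: Bs => // Bs T IH; rewrite map_rcons gates_ok_rcons IH /=.
by rewrite all_map; apply/allP.
Qed.

Lemma middle_values x Bs Ms : all (all [in Bs]) Ms ->
  gate_values x ([seq bottom_gate T | T <- Bs] ++ [seq middle_gate Bs m | m <- Ms]) =
  [seq term_value x T | T <- Bs] ++ [seq has (term_value x) m | m <- Ms].
Proof.
elim/last_ind: Ms => [|Ms m IH]; first by rewrite !cats0 bottom_values.
rewrite all_rcons => /andP[/allP mB /IH{}IH].
rewrite !map_rcons -!rcons_cat gate_values_rcons IH; congr rcons.
rewrite /gate_value /= has_map; apply: eq_in_has => T /mB/= TB /=.
by rewrite nth_cat size_map index_mem TB (nth_map [::]) ?index_mem // nth_index.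
Qed.

Lemma middle_depths Bs Ms : all (all [in Bs]) Ms ->
  all (fun d => d <= 2)
    (gate_depths ([seq bottom_gate T | T <- Bs] ++ [seq middle_gate Bs m | m <- Ms])) /\
  take (size Bs)
    (gate_depths ([seq bottom_gate T | T <- Bs] ++ [seq middle_gate Bs m | m <- Ms])) =
  nseq (size Bs) 1.
Proof.
elim/last_ind: Ms => [|Ms m IH].
  rewrite cats0 bottom_depths take_oversize ?size_nseq //.
  by split=> //; rewrite all_nseq orbT.
rewrite all_rcons => /andP[/allP mB /IH[{}IH1 IH2]].
rewrite map_rcons -rcons_cat gate_depths_rcons all_rcons IH1 andbT.
set ds := gate_depths _ in IH1 IH2 *.
have sds : size Bs <= size ds.
  by have := congr1 size IH2; rewrite size_nseq size_take; case: ltnP => [/ltnW|_ ->].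
split; last by rewrite -cats1 takel_cat.
rewrite ltnS [inputs _]/= big_map; apply/bigmax_leqP_seq => T.
move/mB => /= TB _; rewrite -(nth_take (n0 := size Bs)) ?index_mem // IH2 nth_nseq.
by case: ifP.
Qed.

Lemma middle_ok Bs Ms : all (all [in Bs]) Ms ->
  gates_ok 0 ([seq bottom_gate T | T <- Bs] ++ [seq middle_gate Bs m | m <- Ms]).
Proof.
elim/last_ind: Ms => [|Ms m IH]; first by rewrite cats0 bottom_ok.
rewrite all_rcons => /andP[/allP mB /IH{}IH].
rewrite map_rcons -rcons_cat gates_ok_rcons IH /= all_map; apply/allP => T /mB/= TB /=.
by rewrite add0n size_cat size_map ltn_addr // index_mem.
Qed.

Lemma and_or_and_class (R : realType) Bs Ms Ls (S : R) :
  all (all [in Bs]) Ms -> ((size Bs + size Ms).+1%:R <= S)%R ->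
  circuit_class 3 S
    (fun x => term_value x Ls && all (has (term_value x)) Ms).
Proof.
move=> MB sS; exists (and_or_and Bs Ms Ls); split.
- rewrite /well_formed size_rcons gates_ok_rcons middle_ok //= all_cat !all_map.
  apply/andP; split; first by apply/allP.
  apply/allP => i /=; rewrite mem_iota => /andP[_].
  by rewrite add0n size_cat !size_map.
- rewrite /circuit_depth /and_or_and gate_depths_rcons -cats1 big_cat /= big_seq1.
  have [/allP h _] := middle_depths MB; set ds := gate_depths _ in h *.
  rewrite geq_max ltnS; apply/andP; split.
    by apply/bigmax_leqP_seq => d /h /leqW.
  rewrite big_cat /= !big_map geq_max; apply/andP; split; first by rewrite big1.
  apply/bigmax_leqP_seq => i _ _.
  have [ids|ids] := ltnP i (size ds); last by rewrite /= nth_default.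
  exact/h/mem_nth.
- by rewrite size_rcons size_cat !size_map.
move=> x; rewrite /circuit_value /and_or_and gate_values_rcons last_rcons.
rewrite middle_values // /gate_value /= all_cat !all_map; congr (_ && _).
rewrite -[in iota _ _](size_map (has (term_value x)) Ms).
set ms := map _ Ms; have -> : all (has (term_value x)) Ms = all id ms by rewrite all_map.
set bs := map _ Bs; have -> : size Bs = size bs by rewrite size_map.
apply/idP/allP => [/allP h i|h].
  rewrite mem_iota => /andP[bi ib] /=; rewrite nth_cat ltnNge bi /=.
  by apply: h; rewrite mem_nth // ltn_subLR.
apply/allP => b /(nthP false)[i im <-].
have := h (size bs + i); rewrite mem_iota leq_addr ltn_add2l im.
by move=> /(_ isT) /=; rewrite nth_cat ltnNge leq_addr /= addKn.
Qed.

End AndOrAnd.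

(** * The circuit checking a witness *)

Section WitnessCircuit.
Variables (n q : nat).
Local Notation Y := (Yq n q).
Implicit Types (w : {ffun Y -> bool}) (C : clause n) (F : cnf n).
Implicit Types (g : {ffun Y -> bool} -> bool) (FF : seq (cnf n)).
Implicit Types (vs : seq 'I_n) (X : seq ('I_n * entry n)).

Definition local_vars C : {set Y} :=
  [set y : Y | match y with inl ij => ij.1 \in clause_vars C
                          | inr i => i \in clause_vars C end].

Lemma card_local_vars C : #|local_vars C| <= #|C| * q.+1.
Proof.
have -> : local_vars C =
    [set inl x | x in setX (clause_vars C) [set: 'I_q]] :|: [set inr i | i in clause_vars C].
  apply/setP => -[[i j]|i]; rewrite !inE /=.
    rewrite mem_imset; last exact: inl_inj.
    rewrite !inE andbT; case: (i \in _) => //=; apply/esym/imsetP => -[] //.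
  rewrite mem_imset; last exact: inr_inj.
  by case: (i \in _) => //=; rewrite ?orbT // orbF; apply/esym/imsetP => -[] //.
apply: leq_trans (leq_card_setU _ _) _; rewrite mulnS addnC leq_add //.
  by apply: leq_trans (leq_imset_card _ _) (leq_imset_card _ _).
apply: leq_trans (leq_imset_card _ _) _.
by rewrite cardsX cardsT card_ord leq_mul2r leq_imset_card orbT.
Qed.

Definition minterm C (A : {set Y}) : seq (Y * bool) :=
  [seq (y, y \in A) | y <- enum (local_vars C)].

Definition minterms C : seq (seq (Y * bool)) :=
  [seq minterm C A | A <- enum (powerset (local_vars C))].

Definition dnf C g : seq (seq (Y * bool)) :=
  [seq minterm C A | A : {set Y} <- enum (powerset (local_vars C)) & g [ffun y => y \in A]].

Definition depends_on C g :=
  forall w w', {in local_vars C, w =1 w'} -> g w = g w'.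

(** The minterm satisfied by [w] is that of the local variables true in [w]. There [g] is evaluated
    at a point that is false elsewhere, which [depends_on] makes harmless. *)
Lemma has_dnf C g w : depends_on C g -> has (term_value w) (dnf C g) = g w.
Proof.
move=> gC; apply/hasP/idP => [[T /mapP[A + ->]]|gw].
  rewrite mem_filter => /andP[gA _]; rewrite /term_value all_map => /allP h.
  by rewrite (gC w [ffun y => y \in A]) // => y yC; rewrite ffunE (eqP (h y _)) ?mem_enum.
pose A := [set y in local_vars C | w y]; exists (minterm C A).
  apply: map_f; rewrite mem_filter mem_enum powersetE; apply/andP; split.
    by rewrite (gC _ w) // => y yC; rewrite ffunE inE yC.
  by apply/subsetP => y; rewrite inE => /andP[].
by rewrite /term_value all_map; apply/allP => y; rewrite mem_enum /= [y \in A]in_set => ->.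
Qed.

Lemma dnf_sub C g : {subset dnf C g <= minterms C}.
Proof.
move=> T /mapP[A + ->]; rewrite mem_filter => /andP[_ h]; exact: map_f.
Qed.

Definition all_minterms FF := flatten [seq minterms C | C <- flatten FF].

Lemma size_all_minterms FF Q k : all (is_kCNF Q k) FF ->
  size (all_minterms FF) <= size FF * Q * 2 ^ (k * q.+1).
Proof.
rewrite /all_minterms; elim: FF => //= F FF IH /andP[/andP[/eqP sF /allP hF] /IH{}IH].
rewrite map_cat flatten_cat size_cat mulSn mulnDl leq_add // -sF.
elim: F hF {sF IH} => //= C F IH hF; rewrite size_cat mulSn leq_add //; last first.
  by apply: IH => D DF; apply: hF; rewrite inE DF orbT.
rewrite size_map -cardE card_powerset leq_exp2l //.
by apply: leq_trans (card_local_vars C) _; rewrite leq_mul2r hF ?orbT // mem_head.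
Qed.

Definition live_at vs (bits : seq bool) C w : bool :=
  live (override (assigned vs bits) (rho_of w)) C.

Lemma live_at_depends vs bits C : depends_on C (live_at vs bits C).
Proof.
move=> w w' ww'; apply: live_local => i iC; rewrite ![override _ _ _]ffunE !ffunE.
case: ohead => //; rewrite ww' ?inE //; congr (if _ then _ else _).
by apply: eq_forallb => j; rewrite ww' ?inE.
Qed.

Definition some_live vs bits F := flatten [seq dnf C (live_at vs bits C) | C <- F].

Lemma has_some_live vs bits F w :
  has (term_value w) (some_live vs bits F) = has (live_at vs bits ^~ w) F.
Proof.
rewrite /some_live; elim: F => //= C F IH; rewrite has_cat IH has_dnf //.
exact: live_at_depends.
Qed.

(* The first live clause is good iff some clause is live and every bad clause is
   either not live or preceded by a live one: an AND of ORs of local conditions. *)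
Definition clause_gates vs X (x : 'I_n * entry n) : seq (seq (seq (Y * bool))) :=
  some_live vs x.2.2 x.2.1 ::
  [seq dnf C (fun w => ~~ live_at vs x.2.2 C w) ++
       some_live vs x.2.2 (take (index C x.2.1) x.2.1)
  | C <- undup x.2.1 & ~~ ((x.1 \in clause_vars C) && separated vs X x C)].

Lemma clause_gates_value vs X x w :
  all (has (term_value w)) (clause_gates vs X x) =
  if witness_clause vs (rho_of w) x.2 is Some C then
    (x.1 \in clause_vars C) && separated vs X x C
  else false.
Proof.
rewrite /= has_some_live all_map all_filter.
set tau := override (assigned vs x.2.2) (rho_of w).
rewrite -[has _ x.2.1]/(has (live tau) x.2.1).
set ok := fun C => (x.1 \in clause_vars C) && separated vs X x C.
rewrite (eq_all (a2 := fun C => ~~ ok C ==> ~~ live tau C ||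
          has (live tau) (take (index C x.2.1) x.2.1))); last first.
  move=> C /=; rewrite has_cat has_some_live has_dnf // => w1 w2 h.
  by rewrite (@live_at_depends _ _ _ w1 w2 h).
rewrite /witness_clause -/tau; case FC: first_live_under => [C|]; last first.
  apply/negbTE; rewrite negb_and; apply/orP; left.
  by apply/negP => /first_live_under_has[C]; rewrite FC.
have [CF lC nC] := first_live_underP FC.
have -> : has (live tau) x.2.1 by apply/hasP; exists C.
rewrite andTb; apply/allP/idP => [/(_ C)|okC D].
  by rewrite mem_undup CF lC (negbTE nC) /= implybF negbK => /(_ isT).
rewrite mem_undup => DF; apply/implyP => nD; apply/norP => -[/negPn lD nlD].
by move: nD; have := first_live_under_some DF lD nlD; rewrite FC => -[<-]; rewrite /ok okC.
Qed.

Lemma clause_gates_sub FF vs X x : {subset x.2.1 <= flatten FF} ->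
  all (all [in all_minterms FF]) (clause_gates vs X x).
Proof.
move=> xF; have dnfP C g : C \in x.2.1 -> {subset dnf C g <= all_minterms FF}.
  move=> /xF CF T /dnf_sub Tm; apply/flattenP; exists (minterms C) => //.
  exact: map_f.
have someP bits F : {subset F <= x.2.1} -> {subset some_live vs bits F <= all_minterms FF}.
  by move=> Fx T /flattenP[_ /mapP[C /Fx Cx ->]]; apply: dnfP.
rewrite /=; apply/andP; split; first by apply/allP; apply: someP.
rewrite all_map; apply/allP => C; rewrite mem_filter mem_undup => /andP[_ Cx] /=.
rewrite all_cat; apply/andP; split; apply/allP; first exact: dnfP.
by apply: someP => D /mem_take.
Qed.

(** A clause of width at most [k] is the image of a [k]-tuple of optional literals. With [undup] in
    [clause_gates], this bounds the middle gates without [Q], so that no product of [t] and [Q]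
    enters the size. *)
Lemma card_narrow_clauses k : #|[set C : clause n | #|C| <= k]| <= (2 * n).+1 ^ k.
Proof.
pose f (h : {ffun 'I_k -> option ('I_n * bool)}) : clause n :=
  [set l | [exists i, h i == Some l]].
have -> : (2 * n).+1 ^ k = #|{: {ffun 'I_k -> option ('I_n * bool)}}|.
  by rewrite card_ffun card_option card_prod card_bool !card_ord mulnC.
rewrite -cardsT; apply: leq_trans (leq_imset_card f _).
apply/subset_leq_card/subsetP => C; rewrite inE => Ck; apply/imsetP.
exists [ffun i : 'I_k => onth (enum C) i] => //; apply/setP => l; rewrite inE.
apply/idP/existsP => [lC|[i]].
  have li : index l (enum C) < #|C| by rewrite cardE index_mem mem_enum.
  exists (Ordinal (leq_trans li Ck)); rewrite ffunE /= onthE (nth_map l) -?cardE //.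
  by rewrite nth_index // mem_enum.
rewrite ffunE onthE; have [ilt|ige] := ltnP i (size (enum C)).
  by rewrite (nth_map l) // => /eqP[<-]; rewrite -mem_enum mem_nth.
by rewrite nth_default // size_map.
Qed.

Lemma size_clause_gates vs X x k : all (fun C : clause n => #|C| <= k) x.2.1 ->
  size (clause_gates vs X x) <= ((2 * n).+1 ^ k).+1.
Proof.
move=> /allP xk; rewrite /= ltnS size_map size_filter.
apply: leq_trans (count_size _ _) (leq_trans _ (card_narrow_clauses k)).
rewrite -(card_uniqP (undup_uniq _)); apply/subset_leq_card/subsetP => C.
by rewrite mem_undup inE => /xk.
Qed.

Lemma valid_circuit_class (R : realType) FF Q k vs X (S : R) :
  all (is_kCNF Q k) FF ->
  (forall x, x \in X -> (x.2.1 \in FF) || (x.2.1 == [::])) ->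
  ((size FF * Q * 2 ^ (k * q.+1) + size X * ((2 * n).+1 ^ k).+1).+2%:R <= S)%R ->
  circuit_class 3 S (fun w => valid vs X (rho_of w)).
Proof.
move=> FFk XF sS.
have XF' x : x \in X -> {subset x.2.1 <= flatten FF}.
  move=> /XF /orP[xF C Cx|/eqP -> //]; by apply/flattenP; exists x.2.1.
have Xk x : x \in X -> all (fun C : clause n => #|C| <= k) x.2.1.
  by move=> /XF /orP[/(allP FFk) /andP[]|/eqP ->].
pose Ls : seq (Y * bool) :=
  flatten [seq [seq (inl (x.1, j), true) | j <- enum 'I_q] | x <- X].
(* A repeated variable makes validity constantly false: one OR gate without inputs expresses it, and
   accounts for one unit of the [.+2]; the top gate is the other. *)
pose Ms := if uniq vs then flatten [seq clause_gates vs X x | x <- X] else [:: [::]].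
have MsB : all (all [in all_minterms FF]) Ms.
  rewrite /Ms; case: ifP => // _; apply/allP => m /flattenP[_ /mapP[x xX ->]].
  exact/allP/clause_gates_sub/XF'.
have sMs : size Ms <= (size X * ((2 * n).+1 ^ k).+1).+1.
  rewrite /Ms; case: ifP => // _; apply: leqW.
  have gates_size s : {subset s <= X} ->
      size (flatten [seq clause_gates vs X x | x <- s]) <= size s * ((2 * n).+1 ^ k).+1.
    elim: s => // x s IH sX; rewrite map_cons.
    rewrite -[flatten _]/(clause_gates vs X x ++ flatten _) size_cat.
    rewrite [size (x :: s)]/= mulSnr addnC leq_add //.
      by apply: IH => y ys; apply: sX; rewrite inE ys orbT.
    exact/size_clause_gates/Xk/sX/mem_head.
  exact: gates_size.
have [|c [wf dc sc vc]] := @and_or_and_class _ R _ _ Ls S MsB.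
  apply: le_trans sS; rewrite ler_nat ltnS -addnS leq_add //.
  exact: size_all_minterms.
exists c; split=> // w; rewrite -vc /valid.
have -> : term_value w Ls = all (fun x => rho_of w x.1 == None) X.
  rewrite /Ls; elim: (X) => //= x X' <-; rewrite /term_value all_cat; congr (_ && _).
  rewrite all_map ffunE.
  have -> : all (preim (fun j : 'I_q => (inl (x.1, j) : Y, true))
                   (fun l => w l.1 == l.2)) (enum 'I_q) = [forall j, w (inl (x.1, j))].
    apply/allP/forallP => h j; have := h j; rewrite /= ?mem_enum.
      by move=> /(_ isT)/eqP.
    by move=> ->.
  by case: ifP.
rewrite /Ms; case: ifP => [uvs|_] /=; last by rewrite andbF.
congr (_ && _).
have gatesE s : all (has (term_value w)) (flatten [seq clause_gates vs X x | x <- s]) =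
    all (fun x => if witness_clause vs (rho_of w) x.2 is Some C then
                    (x.1 \in clause_vars C) && separated vs X x C else false) s.
  elim: s => // x s IH; rewrite map_cons.
  by rewrite -[flatten _]/(clause_gates vs X x ++ flatten _) all_cat clause_gates_value IH.
by rewrite gatesE.
Qed.

End WitnessCircuit.

(** * Union bound over the witnesses *)

Section UnionBound.
Local Open Scope ring_scope.
Variables (R : realType) (T : finType).

Lemma expectation_uniform (f : T -> bool) :
  expectation (uniform R T) f = #|[set x | f x]|%:R / #|T|%:R.
Proof.
rewrite /expectation -sum1dep_card natr_sum mulr_suml [RHS]big_mkcond /=.
by apply: eq_bigr => x _; rewrite ffunE mulrC; case: (f x); rewrite ?mul0r.
Qed.

Lemma Pr_fooled_union (W : finType) (D : {ffun T -> R}) (A : pred T)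
    (f : W -> T -> bool) (gamma : R) :
  is_distribution D -> (forall x, A x -> exists u, f u x) ->
  (forall u, `|expectation D (f u) - expectation (uniform R T) (f u)| <= gamma) ->
  Pr D A <= \sum_u expectation (uniform R T) (f u) + #|W|%:R * gamma.
Proof.
move=> [D0 _] Af fool; apply: (@le_trans _ _ (\sum_u expectation D (f u))).
  rewrite /Pr /expectation exchange_big /= big_mkcond /=.
  apply: ler_sum => x _; rewrite -mulr_sumr; case: ifPn => [/Af[u fu]|_].
    rewrite -[leLHS]mulr1 ler_wpM2l // (bigD1 u) //= fu lerDl.
    by apply: sumr_ge0 => v _; rewrite ler0n.
  by apply: mulr_ge0 => //; apply: sumr_ge0 => v _; rewrite ler0n.
rewrite mulr_natl -sumr_const -big_split /=.
apply: ler_sum => u _; rewrite -lerBlDl.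
exact: le_trans (ler_norm _) (fool u).
Qed.

End UnionBound.

(** Origin of the constants 6 and 2. As n >= 2, 2n + 1 <= n^3, so (2n + 1)^k <= n^(3l); a second
    factor n^(3l) absorbs [t] and the additive terms. For the minterms, q + 1 <= 2q. *)
Lemma witness_circuit_size n M Q k q l t :
  1 < n -> t <= n -> k <= l -> 0 < l -> 0 < q -> 0 < M ->
  (M * Q * 2 ^ (k * q.+1) + t * ((2 * n).+1 ^ k).+1).+2 <=
  M * (n ^ (6 * l) + Q * 2 ^ (2 * k * q)).
Proof.
move=> n1 tn kl l0 q0 M0; have n0 := ltnW n1.
rewrite mulnDr addnC -!addSn leq_add //; last first.
  rewrite mulnA leq_mul2l leq_exp2l // [2 * k]mulnC -mulnA leq_mul2l.
  by apply/orP; right; apply/orP; right; rewrite mul2n -addnn -addn1 leq_add2l.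
apply: leq_trans (leq_pmull _ M0).
have e1 : (2 * n).+1 ^ k <= n ^ (3 * l).
  apply: (@leq_trans ((n ^ 3) ^ k)); last first.
    by rewrite -expnM leq_pexp2l // leq_mul2l kl orbT.
  case: (k) => // k'; rewrite leq_exp2r //.
  apply: (@leq_trans (n * 4)); first by lia.
  by rewrite (expnD n 1 2) leq_mul2l (leq_exp2r 2 n (isT : 0 < 2)) n1 orbT.
have e2 : 1 < n ^ (3 * l) by rewrite -[1](expn0 n) ltn_exp2l // muln_gt0 l0.
have e3 : 6 * l = 3 * l + 3 * l by rewrite -mulnDl.
have e4 : n ^ 3 <= n ^ (3 * l) by rewrite leq_pexp2l // leq_pmulr.
rewrite e3 expnD; set N := n ^ (3 * l) in e1 e2 e4 *.
apply: (@leq_trans (n ^ 3 * N)); last by rewrite leq_mul2r e4 orbT.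
apply: (@leq_trans (n * (N + N) + N)); last first.
  rewrite addnn -mul2n mulnA -mulSnr leq_mul2r; apply/orP; right.
  apply: (@leq_trans (n * 4)); first by lia.
  by rewrite (expnD n 1 2) leq_mul2l (leq_exp2r 2 n (isT : 0 < 2)) n1 orbT.
rewrite -addn2 leq_add // leq_mul // -addn1 leq_add //.
exact: ltnW.
Qed.

(** * Witnesses of a list of formulas, counted by shape *)

Lemma subset_tnth (A : eqType) M (FF : M.-tuple A) (s : seq A) :
  {subset s <= FF} -> exists s' : seq 'I_M, [seq tnth FF i | i <- s'] = s.
Proof.
elim: s => [|F s IH] sF; first by exists [::].
have [|s' <-] := IH; first by move=> x xs; apply: sF; rewrite inE xs orbT.
by have /tnthP[i ->] := sF F (mem_head _ _); exists (i :: s').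
Qed.

Section MultiSwitching.
Variables (n M Q k q l t : nat) (FF : M.-tuple (cnf n)).
Hypothesis FFk : forall i, is_kCNF Q k (tnth FF i).
Hypotheses (l0 : 0 < l) (t0 : 0 < t).
Local Notation c := (ceil_div t l).
Local Notation shape := (t.-tuple mark * c.-tuple 'I_M)%type.

(** A shape is a witness without its variables. It alone determines the entries, so that
    [sum_card_valid] applies with a fixed [L]. *)
Definition shape_entries (z : shape) : seq (entry n) :=
  entries [seq tnth FF i | i <- z.2] [::] [::] [::] z.1.

Lemma size_shape_entries z : size (shape_entries z) = t.
Proof. by rewrite size_entries size_tuple. Qed.

Lemma FF_kCNF : all (is_kCNF Q k) FF.
Proof. by apply/allP => F /tnthP[i ->]. Qed.

Lemma shape_entries_mem z a : a \in shape_entries z ->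
  (a.1 \in (FF : seq _)) || (a.1 == [::]).
Proof.
by move=> /entries_mem /orP[/mapP[i _ ->]|->]; rewrite ?mem_tnth ?orbT.
Qed.

Lemma shape_entries_width z a : a \in shape_entries z ->
  forall C, C \in a.1 -> #|C| <= k.
Proof.
move=> /shape_entries_mem /orP[/(allP FF_kCNF)/andP[_ /allP h] C /h //|/eqP -> //].
Qed.

Lemma shape_entries_bits z m : m < t ->
  size (nth ([::], [::]) (shape_entries z) m).2 <= m.
Proof.
by move=> mt; have := @entries_size_le _ [seq tnth FF i | i <- z.2] [::] [::] [::] z.1 m
  erefl isT; rewrite size_tuple; apply.
Qed.

(** A single deep restriction rules out degenerate parameters: the witness variables are distinct,
    the first one lies in a clause of width at most [k], and the shape contains at least one formula
    index. *)
Lemma ccdt_depth_shape rho :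
  t <= ccdt_depth l k (restrict_list rho FF) ->
  [/\ l < n, t <= n, 0 < M, 0 < k &
    exists (vs : t.-tuple 'I_n) z, valid vs (zip vs (shape_entries z)) rho].
Proof.
move=> /(ccdt_depth_witness l0 t0)[ln [vs [zs [idx [/eqP svs /eqP szs sidx idxF v]]]]].
have [idx' idxE] := subset_tnth idxF.
have sidx' : size idx' == c by rewrite -sidx -idxE size_map.
pose vs' := Tuple svs; pose z : shape := (Tuple szs, Tuple sidx').
have v' : valid vs' (zip vs' (shape_entries z)) rho by rewrite /shape_entries /= idxE.
have [C [FC vC _]] := valid_nth (size_shape_entries z) (tnth vs' (Ordinal t0)) v' t0.
have [CF _ _] := first_live_underP FC.
split=> //; last by exists vs', z.
- rewrite -(size_tuple vs') -[leqRHS]card_ord.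
  by case/and3P: v' => u _ _; rewrite -(card_uniqP u) max_card.
- have c0 : 0 < c.
    by rewrite /ceil_div divn_gt0 // -{1}(prednK l0) -addn1 addnC leq_add2r.
  by case: (tnth z.2 (Ordinal c0)) => m; apply: leq_ltn_trans.
- have eL : nth ([::], [::]) (shape_entries z) 0 \in shape_entries z.
    by rewrite mem_nth // size_shape_entries.
  apply: leq_trans (shape_entries_width eL CF).
  by apply/card_gt0P; case/imsetP: vC => x xC _; exists x.
Qed.

(** [sum_card_valid] is applied to each shape. A mark has 12 values: two bits and three ways of
    closing. *)
Lemma sum_expectation_valid (R : realType) : 0 < q -> 0 < k ->
  (\sum_(u : t.-tuple 'I_n * shape)
    expectation (uniform R {ffun Yq n q -> bool})
      (fun w => valid u.1 (zip u.1 (shape_entries u.2)) (rho_of w)) <=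
  12 ^+ t * M%:R ^+ c * (2 * k%:R / (2 ^+ q - 1)) ^+ t)%R.
Proof.
move=> q0 k0.
rewrite -(pair_bigA _ (fun (vs : t.-tuple 'I_n) (z : shape) =>
    expectation (uniform R {ffun Yq n q -> bool})
      (fun w => valid vs (zip vs (shape_entries z)) (rho_of w)))) exchange_big /=.
have -> : (12 ^+ t * M%:R ^+ c = #|{: shape}|%:R :> R)%R.
  by rewrite card_prod !card_tuple !card_prod card_option card_bool card_ord natrM !natrX.
rewrite [leRHS]mulr_natl -sumr_const; apply: ler_sum => z _.
under eq_bigr do rewrite expectation_uniform.
rewrite -mulr_suml -natr_sum.
have := @sum_card_valid n q k.-1 t (shape_entries z) (size_shape_entries z)
  (@shape_entries_bits z).
rewrite prednK // => /(_ (@shape_entries_width z)).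
have p2 : (0 < 2 ^+ q - 1 :> R)%R by rewrite subr_gt0 exprn_egt1 ?ltr1n // -lt0n.
rewrite -(ler_nat R) !natrM !natrX natrM => h.
rewrite card_ffun card_bool natrX ler_pdivrMr ?exprn_gt0 // expr_div_n.
rewrite mulrAC ler_pdivlMr ?exprn_gt0 //; apply: le_trans h.
by rewrite -subn1 natrB ?expn_gt0 // natrX.
Qed.

End MultiSwitching.

(** * Choice of the constants and final estimate *)

Local Open Scope ring_scope.

Theorem theorem4p3 (R : realType) :
  exists c1 c2 c3 : R, [/\ 0 < c1, 0 < c2, 0 < c3 &
    forall (n M Q k q l t : nat) (FF : M.-tuple (cnf n)) (delta p : R)
           (D : {ffun {ffun Yq n q -> bool} -> R}),
      (forall i : 'I_M, is_kCNF Q k (tnth FF i)) ->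
      0 < delta < 1 -> 0 < p < 1 ->
      (0 < q)%N -> q%:R = ln (1 / p) / ln 2 ->
      (0 < l)%N -> (k <= l)%N ->
      is_distribution D ->
      fools D
        (delta / (M%:R ^+ ceil_div t l * n%:R `^ (c1 * t%:R)))
        (circuit_class 3
          (M%:R * (n%:R `^ (c2 * l%:R) + Q%:R * 2 `^ (c3 * k%:R * q%:R)))) ->
      Pr D (fun w => (t <= ccdt_depth l k (restrict_list (rho_of w) FF))%N)
        <= 16 ^+ (t + l) * M%:R ^+ ceil_div t l * (32 * p * k%:R) ^+ t + delta].
Proof.
exists 5, 6, 2; split=> // n M Q k q l t FF delta p D FFk /andP[d0 _] /andP[p0 _].
move=> q0 qp l0 kl Dd Df.
have {qp} pE : p = (2 ^+ q)^-1.
  have ln2 : ln 2 != 0 :> R by rewrite gt_eqF // ln_gt0 // ltr1n.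
  have : ln (1 / p) = ln (2 ^+ q) by rewrite lnXn // -[ln 2 *+ q]mulr_natl qp divfK.
  by move/ln_inj; rewrite !posrE exprn_gt0 // div1r invr_gt0 p0 => /(_ isT isT) <-; rewrite invrK.
have main0 : 0 <= 16 ^+ (t + l) * M%:R ^+ ceil_div t l * (32 * p * k%:R) ^+ t :> R.
  by rewrite !mulr_ge0 ?exprn_ge0 ?mulr_ge0 ?ler0n ?(ltW p0).
(* If no point reaches depth [t] the probability is 0; otherwise such a point yields, for [t]
   positive, the bounds on the parameters needed below. *)
have [/existsP[w0 Ew0]|] := boolP [exists w : {ffun Yq n q -> bool},
  (t <= ccdt_depth l k (restrict_list (rho_of w) FF))%N]; last first.
  rewrite negb_exists => /forallP nE; rewrite /Pr big1; first exact: addr_ge0 main0 (ltW d0).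
  by move=> w Ew; case/negP: (nE w).
have [t0|t0] := posnP t.
  apply: (@le_trans _ _ 1).
    have [D0 <-] := Dd; rewrite /Pr big_mkcond; apply: ler_sum => w _.
    by case: ifP.
  rewrite t0 /ceil_div add0n divn_small ?prednK // !expr0 !mulr1.
  rewrite -[leLHS]addr0; apply: lerD; last exact: ltW.
  by rewrite exprn_ege1 // ler1n.
have [ln tn M0 k0 _] := ccdt_depth_shape FFk l0 t0 Ew0.
have n1 : (1 < n)%N by apply: leq_ltn_trans ln.
have n0 : (0 : R) < n%:R by rewrite ltr0n ltnW.
pose f (u : t.-tuple 'I_n * (t.-tuple mark * (ceil_div t l).-tuple 'I_M))
  (w : {ffun Yq n q -> bool}) := valid u.1 (zip u.1 (shape_entries FF u.2)) (rho_of w).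
have pow (a : R) (b c : nat) : 0 < a -> a `^ (b%:R * c%:R) = a ^+ (b * c).
  by move=> a0; rewrite -natrM powR_mulrn // ltW.
apply: le_trans (Pr_fooled_union (f := f) Dd _ _) _.
- by move=> w /(ccdt_depth_shape FFk l0 t0)[_ _ _ _ [vs [z vz]]]; exists (vs, z).
- move=> [vs z]; apply: Df; apply: (@valid_circuit_class _ _ R FF Q k).
  + exact: FF_kCNF.
  + move=> x xX; apply: (@shape_entries_mem _ _ _ _ FF z).
    rewrite -(@unzip2_zip _ _ vs (shape_entries FF z)) ?map_f //.
    by rewrite size_shape_entries size_tuple.
  rewrite size_zip size_shape_entries !size_tuple minnn.
  have -> : M%:R * (n%:R `^ (6 * l%:R) + Q%:R * 2 `^ (2 * k%:R * q%:R)) =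
      (M * (n ^ (6 * l) + Q * 2 ^ (2 * k * q)))%:R :> R.
    by rewrite natrM natrD natrM !natrX pow // -natrM pow.
  by rewrite ler_nat witness_circuit_size.
apply: lerD.
  apply: le_trans (sum_expectation_valid l t FFk R q0 k0) _.
  rewrite mulrAC [leRHS]mulrAC ler_wpM2r ?exprn_ge0 ?ler0n // -!exprMn.
  have z2 : 2 <= 2 ^+ q :> R by rewrite -[leLHS]expr1 ler_weXn2l // ler1n.
  (* Since q >= 1, 2^q - 1 is at least half of 2^q. Each variable then costs at most 12 * 4pk =
     48pk, well below 16 * 32pk. *)
  have ip : (2 ^+ q - 1)^-1 <= 2 * p :> R.
    rewrite pE -[leLHS]mul1r ler_pdivrMr; last lra.
    by rewrite mulrAC ler_pdivlMr ?exprn_gt0 //; lra.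
  have i0 : 0 <= (2 ^+ q - 1)^-1 :> R by rewrite invr_ge0; lra.
  have kip := ler_wpM2l (ler0n R k) ip; have kp0 := mulr_ge0 (ler0n R k) (ltW p0).
  have ki0 := mulr_ge0 (ler0n R k) i0.
  rewrite exprD [leRHS]mulrAC -[16 ^+ t * _]exprMn -[leLHS]mulr1.
  apply: ler_pM; rewrite ?exprn_ege1 ?ler1n //; first by apply: exprn_ge0; lra.
  by rewrite lerXn2r ?nnegrE //; lra.
rewrite card_prod card_prod !card_tuple !card_prod card_option card_bool !card_ord.
rewrite pow // -!natrX -natrM mulrA ler_pdivrMr; last first.
  by rewrite ltr0n muln_gt0 !expn_gt0 M0 (ltnW n1).
(* The variables and marks of a witness have (12n)^t choices, and 12n <= n^5 because n >= 2: hence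
   c1 = 5. *)
rewrite mulrC ler_pM2l // ler_nat mulnA [leqRHS]mulnC leq_mul2r; apply/orP; right.
rewrite (expnM n 5 t) -expnMn leq_exp2r // (expnD n 1 4) leq_mul2l; apply/orP; right.
by apply: (@leq_trans (2 ^ 4)); rewrite // leq_exp2r.
Qed.
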